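(* Consider the rows of operads $$pre\mathcal{L}ie\to\mathcal{D}end\to\mathcal{Z}inb,\qquad \mathcal{L}ie\to\mathcal{A}ss\to\mathcal{C}om,\qquad \mathcal{L}eib\to di\mathcal{A}ss\to\mathcal{P}erm .$$ The first row is the Manin white product of the second row with $\mathcal{Z}inb$, and the third row is the Manin black product of the second row with $\mathcal{L}eib$. That is, up to isomorphism, the first row is obtained by applying the functor $-\circ\mathcal{Z}inb$ to $\mathcal{L}ie\to\mathcal{A}ss\to\mathcal{C}om$ (in particular $\mathcal{L}ie\circ\mathcal{Z}inb\cong pre\mathcal{L}ie$, $\mathcal{A}ss\circ\mathcal{Z}inb\cong\mathcal{D}end$, $\mathcal{C}om\circ\mathcal{Z}inb\cong\mathcal{Z}inb$), and the third row is obtained by applying the functor $-\bullet\mathcal{L}eib$ to it (in particular $\mathcal{L}ie\bullet\mathcal{L}eib\cong\mathcal{L}eib$, $\mathcal{A}ss\bullet\mathcal{L}eib\cong di\mathcal{A}ss$, $\mathcal{C}om\bullet\mathcal{L}eib\cong\mathcal{P}erm$).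
   Context: All operads are finitely generated binary quadratic symmetric operads in vector spaces over a field $\mathbb{K}$; $\mathbf{Op}$ denotes their category. Manin products. For $\mathcal{O},\mathcal{P}\in\mathbf{Op}$ the white product $\mathcal{O}\circ\mathcal{P}\in\mathbf{Op}$ is generated by $\mathcal{O}(2)\otimes\mathcal{P}(2)$ (diagonal $S_2$-action) with all ternary quadratic relations that hold in $\mathcal{O}(3)\otimes\mathcal{P}(3)$, i.e. that hold for the tensor product operations on $A\otimes V$ for all $\mathcal{O}$-algebras $A$ and $\mathcal{P}$-algebras $V$. The black product is $\mathcal{O}\bullet\mathcal{P}=(\mathcal{O}^!\circ\mathcal{P}^!)^!$, where $(-)^!$ is Koszul duality of binary quadratic operads. Both are functorial in each argument. The operads (algebras over them, relations for all $x,y,z$): - $\mathcal{L}ie$, $\mathcal{A}ss$, $\mathcal{C}om$: Lie, associative, commutative associative algebras. - $pre\mathcal{L}ie$ (right pre-Lie): $(x\cdot y)\cdot z-x\cdot(y\cdot z)=(x\cdot z)\cdot y-x\cdot(z\cdot y)$. - $\mathcal{D}end$ (dendriform), products $\prec,\succ$: $(x\prec y)\prec z=x\prec(y\prec z+y\succ z)$, $(x\succ y)\prec z=x\succ(y\prec z)$, $x\succ(y\succ z)=(x\prec y+x\succ y)\succ z$. - $\mathcal{Z}inb$ (right Zinbiel): $(x\cdot y)\cdot z=x\cdot(y\cdot z+z\cdot y)$. - $\mathcal{L}eib$ (right Leibniz): $(x\cdot y)\cdot z=x\cdot(y\cdot z)+(x\cdot z)\cdot y$. - $di\mathcal{A}ss$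 (diassociative), products $\prec,\succ$: $(x\prec y)\prec z=x\prec(y\prec z)=x\prec(y\succ z)$, $(x\succ y)\prec z=x\succ(y\prec z)$, $(x\prec y)\succ z=(x\succ y)\succ z=x\succ(y\succ z)$. - $\mathcal{P}erm$ (right permutative): $(x\cdot y)\cdot z=x\cdot(y\cdot z)=x\cdot(z\cdot y)$. The arrows: $\mathcal{L}ie\to\mathcal{A}ss$ sends $[x,y]$ to $xy-yx$; $\mathcal{A}ss\to\mathcal{C}om$ sends the product to the product; $pre\mathcal{L}ie\to\mathcal{D}end$ and $\mathcal{L}eib\to di\mathcal{A}ss$ send $x\cdot y$ to $x\prec y-y\succ x$; $\mathcal{D}end\to\mathcal{Z}inb$ and $di\mathcal{A}ss\to\mathcal{P}erm$ send $x\prec y$ to $x\cdot y$ and $x\succ y$ to $y\cdot x$. *)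

(* Defs.v *)
From HB Require Import structures.
From mathcomp Require Import all_boot all_order all_algebra.
From mathcomp Require Import fingroup perm ring.

Set Implicit Arguments.
Unset Strict Implicit.
Unset Printing Implicit Defensive.

Import GRing.Theory.
Local Open Scope ring_scope.

(* The vector space with basis I. *)
Notation vec K I := {ffun I -> K^o}.
Notation vecT K I := [the vectType K of vec K I].

Section LinearAlgebra.
Variable K : fieldType.
Implicit Types I J L : finType.

Definition bas I (i : I) : vec K I := [ffun j => ((j == i)%:R : K)].

Definition linext_fun I (V : vectType K) (b : I -> V) (v : vec K I) : V :=
  \sum_i v i *: b i.

Fact linext_fun_linear I (V : vectType K) (b : I -> V) :
  linear (linext_fun b).
Proof.
move=> a u v; rewrite /linext_fun scaler_sumr -big_split /=.
by apply: eq_bigr => i _; rewrite !ffunE scalerDl scalerA.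
Qed.

HB.instance Definition _ I (V : vectType K) (b : I -> V) :=
  GRing.isLinear.Build K (vec K I) V _ (linext_fun b) (linext_fun_linear b).

(* The linear map with prescribed values on the basis. *)
Definition linext I (V : vectType K) (b : I -> V) : 'Hom(vecT K I, V) :=
  linfun (linext_fun b).

Definition tens I J (u : vec K I) (v : vec K J) : vec K (I * J)%type :=
  [ffun p => ((u p.1 : K) * (v p.2 : K) : K)].

Definition tensh I J I' J' (f : 'Hom(vecT K I, vecT K I'))
    (g : 'Hom(vecT K J, vecT K J')) :
    'Hom(vecT K (I * J)%type, vecT K (I' * J')%type) :=
  linext (fun p => tens (f (bas p.1)) (g (bas p.2))).

(* The dual space is given the dual basis, hence is again vec K I. *)
Definition transp I J (f : 'Hom(vecT K I, vecT K J)) : 'Hom(vecT K J, vecT K I) :=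
  linext (fun j => [ffun i => f (bas i) j]).

Definition pairing I (u : vec K I) : 'Hom(vecT K I, K^o) :=
  linext (fun i => u i).

Definition annihilator I (U : {vspace vecT K I}) : {vspace vecT K I} :=
  (\bigcap_(i < \dim U) lker (pairing (vbasis U)`_i))%VS.

Lemma linextE I (V : vectType K) (b : I -> V) v :
  linext b v = \sum_i v i *: b i.
Proof. exact: lfunE. Qed.

Lemma vec_sum I (v : vec K I) : v = \sum_i v i *: bas i.
Proof.
apply/ffunP => j; rewrite sum_ffunE (bigD1 j) //= big1 => [|i /negPf ij].
  by rewrite !ffunE eqxx addr0; exact/esym/mulr1.
by rewrite !ffunE eq_sym ij; exact: mulr0.
Qed.

Lemma basE I (i j : I) : bas i j = ((j == i)%:R : K).
Proof. by rewrite ffunE. Qed.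

Lemma lfun_vec I (V : vectType K) (f : 'Hom(vecT K I, V)) v :
  f v = \sum_i v i *: f (bas i).
Proof.
by rewrite {1}(vec_sum v) linear_sum; apply: eq_bigr => i _; rewrite linearZ.
Qed.

Lemma linext_bas I (V : vectType K) (b : I -> V) i : linext b (bas i) = b i.
Proof.
rewrite linextE (bigD1 i) //= big1 ?basE ?eqxx ?scale1r ?addr0 // => j /negPf ji.
by rewrite basE ji scale0r.
Qed.

Lemma lfun_bas_eq I (V : vectType K) (f g : 'Hom(vecT K I, V)) :
  (forall i, f (bas i) = g (bas i)) -> f = g.
Proof.
by move=> fg; apply/lfunP => v; rewrite !lfun_vec; apply: eq_bigr => i _; rewrite fg.
Qed.

Lemma tens_bas I J (i : I) (j : J) : tens (bas i) (bas j) = bas (i, j).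
Proof.
apply/ffunP => -[a b]; rewrite !ffunE -natrM xpair_eqE /=.
by case: (a == i); case: (b == j).
Qed.

Lemma tensh_tens I J I' J' (f : 'Hom(vecT K I, vecT K I'))
    (g : 'Hom(vecT K J, vecT K J')) u v : tensh f g (tens u v) = tens (f u) (g v).
Proof.
rewrite linextE; apply/ffunP => -[a b].
rewrite sum_ffunE ffunE /= (lfun_vec f) (lfun_vec g) !sum_ffunE big_distrl /=.
under [RHS]eq_bigr => i _ do rewrite big_distrr /=.
rewrite pair_bigA; apply: eq_bigr => -[i j] _ /=.
by rewrite !ffunE /=; exact: mulrACA.
Qed.

Lemma tensh_comp I J I' J' I'' J'' (f : 'Hom(vecT K I, vecT K I'))
    (g : 'Hom(vecT K J, vecT K J')) (f' : 'Hom(vecT K I', vecT K I''))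
    (g' : 'Hom(vecT K J', vecT K J'')) :
  (tensh f' g' \o tensh f g)%VF = tensh (f' \o f)%VF (g' \o g)%VF.
Proof.
apply: lfun_bas_eq => -[i j].
by rewrite -tens_bas comp_lfunE !tensh_tens !comp_lfunE.
Qed.

Lemma tensh1 I J : tensh \1 \1 = (\1 : 'End(vecT K (I * J)%type))%VF.
Proof.
by apply: lfun_bas_eq => -[i j]; rewrite -tens_bas tensh_tens !id_lfunE.
Qed.

Lemma transpE I J (f : 'Hom(vecT K I, vecT K J)) v i :
  transp f v i = \sum_j (v j : K) * (f (bas i) j : K) :> K.
Proof. by rewrite linextE sum_ffunE; apply: eq_bigr => j _; rewrite !ffunE. Qed.

Lemma transp_comp I J L (f : 'Hom(vecT K I, vecT K J)) (g : 'Hom(vecT K J, vecT K L)) :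
  transp (g \o f)%VF = (transp f \o transp g)%VF.
Proof.
apply/lfunP => v; apply/ffunP => i; rewrite comp_lfunE !transpE.
under [RHS]eq_bigr => j _ do rewrite transpE mulr_suml.
rewrite exchange_big; apply: eq_bigr => l _; rewrite comp_lfunE.
rewrite (lfun_vec g) sum_ffunE mulr_sumr; apply: eq_bigr => j _.
by rewrite ffunE -mulrA; congr (_ * _); exact: mulrC.
Qed.

Lemma transp_id I : transp (\1 : 'End(vecT K I))%VF = \1%VF.
Proof.
apply: lfun_bas_eq => j; rewrite linext_bas id_lfunE.
by apply/ffunP => i; rewrite ffunE id_lfunE !basE eq_sym.
Qed.

Lemma pairingE I (u v : vec K I) : pairing u v = \sum_i (u i : K) * (v i : K) :> K.
Proof. by rewrite linextE; apply: eq_bigr => i _; exact: mulrC. Qed.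

Lemma pairingC I (u v : vec K I) : pairing u v = pairing v u.
Proof. by rewrite !pairingE; apply: eq_bigr => i _; exact: mulrC. Qed.

Lemma pairing_transp I J (f : 'Hom(vecT K I, vecT K J)) u v :
  pairing u (f v) = pairing (transp f u) v.
Proof.
rewrite !pairingE; under [RHS]eq_bigr => i _ do rewrite transpE mulr_suml.
rewrite exchange_big; apply: eq_bigr => j _; rewrite (lfun_vec f) sum_ffunE.
rewrite mulr_sumr; apply: eq_bigr => i _; rewrite ffunE -mulrA; congr (_ * _).
exact: mulrC.
Qed.

Lemma annihilatorP I (U : {vspace vecT K I}) v :
  reflect (forall u, u \in U -> pairing u v = 0) (v \in annihilator U).
Proof.
apply: (iffP idP) => [/subv_bigcapP vU u /coord_vbasis -> | vU].
  rewrite pairingC linear_sum big1 // => i _; rewrite linearZ /= pairingC.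
  have := vU i isT; rewrite -memvE memv_ker => /eqP ->; exact: scaler0.
apply/subv_bigcapP => i _; rewrite -memvE memv_ker; apply/eqP/vU.
by rewrite vbasis_mem ?mem_nth ?size_tuple.
Qed.

Lemma transp_tensh I J I' J' (f : 'Hom(vecT K I, vecT K I'))
    (g : 'Hom(vecT K J, vecT K J')) :
  transp (tensh f g) = tensh (transp f) (transp g).
Proof.
apply: lfun_bas_eq => -[i' j']; rewrite -[in RHS]tens_bas tensh_tens.
rewrite !linext_bas; apply/ffunP => -[i j].
by rewrite ffunE linext_bas !ffunE /=.
Qed.

Lemma tenshNr I J I' J' (f : 'Hom(vecT K I, vecT K I'))
    (g : 'Hom(vecT K J, vecT K J')) : tensh f (- g) = - tensh f g.
Proof.
apply: lfun_bas_eq => -[i j]; rewrite opp_lfunE !linext_bas /= opp_lfunE.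
by apply/ffunP => p; rewrite !ffunE; exact: mulrN.
Qed.

End LinearAlgebra.

(* A finite-dimensional S_2-module with a chosen basis: [swap] is the action of
   the transposition, so a generator mu(x, y) has swap mu (x, y) = mu(y, x). *)
Record s2mod (K : fieldType) := S2Mod {
  gens : finType;
  swap : 'End(vecT K gens);
  swapK : (swap \o swap = \1)%VF }.

Lemma I3_cases (P : 'I_3 -> Prop) : P 0 -> P 1 -> P 2%:R -> forall i, P i.
Proof.
move=> P0 P1 P2 [[|[|[|//]]] Hi].
- by rewrite (_ : Ordinal Hi = 0) //; exact: val_inj.
- by rewrite (_ : Ordinal Hi = 1) //; exact: val_inj.
- by rewrite (_ : Ordinal Hi = 2%:R) //; exact: val_inj.
Qed.

Lemma perm3_parity (s : 'S_3) i j k : uniq [:: i; j; k] ->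
  (s i == s k + 1) = (i == k + 1) (+) odd_perm s.
Proof.
have [ts -> _] := prod_tpermP s; elim: ts i j k => [|[x y] ts IH] i j k ijk.
  by rewrite big_nil odd_perm1 addbF !perm1.
rewrite big_cons odd_permM !permM /= (IH _ (tperm x y j)); last first.
  by have := map_inj_uniq (@perm_inj _ (tperm x y)) [:: i; j; k] => /= ->.
rewrite addbA; congr (_ (+) _); rewrite odd_tperm !permE /=.
by move: x y i j k ijk; do 5! [elim/I3_cases].
Qed.

Section Ternary.
Variable K : fieldType.
Implicit Types E F : s2mod K.

(* Basis of the arity 3 part F(E)(3) of the free operad on E, which is
   three copies of E (x) E.  With variables x_0, x_1, x_2 and indices mod 3,
   the basis vector (k, u, v) is the operation u (v (x_(k+1), x_(k+2)), x_k). *)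
Definition tern E : finType := ('I_3 * gens E * gens E)%type.

Definition tree E (k : 'I_3) (u v : vec K (gens E)) : vec K (tern E) :=
  tens (tens (bas K k) u) v.

(* For pairwise distinct i, j, k, lmon i v j u k is (x_i v x_j) u x_k and
   rmon i u j v k is x_i u (x_j v x_k).  As j is determined by i and k, only
   the position of i decides whether (i, j) is (k + 1, k + 2) or its reverse. *)
Definition lmon E (i : 'I_3) (v : vec K (gens E)) (j : 'I_3)
    (u : vec K (gens E)) (k : 'I_3) : vec K (tern E) :=
  tree k u (if i == k + 1 then v else swap E v).

Definition rmon E (i : 'I_3) (u : vec K (gens E)) (j : 'I_3)
    (v : vec K (gens E)) (k : 'I_3) : vec K (tern E) :=
  lmon j v k (swap E u) i.

Definition relabel (s : 'S_3) : 'End(vecT K 'I_3) :=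
  linext (fun k => bas K (s k)).

Definition act E (s : 'S_3) : 'End(vecT K (tern E)) :=
  tensh (tensh (relabel s) \1%VF) (if odd_perm s then swap E else \1%VF).

(* The map F(E)(3) -> F(F)(3) induced by a map E -> F. *)
Definition ternh E F (f : 'Hom(vecT K (gens E), vecT K (gens F))) :
    'Hom(vecT K (tern E), vecT K (tern F)) :=
  tensh (tensh \1%VF f) f.

Lemma relabel_comp s t : (relabel t \o relabel s = relabel (s * t)%g)%VF.
Proof.
by apply: lfun_bas_eq => k; rewrite comp_lfunE !linext_bas permM.
Qed.

Lemma relabel1 : relabel 1%g = \1%VF.
Proof. by apply: lfun_bas_eq => k; rewrite linext_bas perm1 id_lfunE. Qed.

Lemma act_comp E s t : (act E t \o act E s = act E (s * t)%g)%VF.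
Proof.
rewrite /act !tensh_comp relabel_comp comp_lfun1l odd_permM; congr tensh.
by case: (odd_perm s); case: (odd_perm t);
  rewrite /= ?swapK ?comp_lfun1l ?comp_lfun1r.
Qed.

Lemma act1 E : act E 1%g = \1%VF.
Proof. by rewrite /act relabel1 odd_perm1 !tensh1. Qed.

Lemma act_tree E s k (u v : vec K (gens E)) :
  act E s (tree k u v) = tree (s k) u (if odd_perm s then swap E v else v).
Proof.
rewrite !tensh_tens linext_bas id_lfunE.
by case: (odd_perm s); rewrite ?id_lfunE.
Qed.

Lemma act_lmon E s i j k (u v : vec K (gens E)) : uniq [:: i; j; k] ->
  act E s (lmon i v j u k) = lmon (s i) v (s j) u (s k).
Proof.
move=> ijk; rewrite /lmon act_tree (perm3_parity s ijk); congr tree.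
case: (i == k + 1); case: (odd_perm s) => //=.
by rewrite -comp_lfunE swapK id_lfunE.
Qed.

Lemma act_rmon E s i j k (u v : vec K (gens E)) : uniq [:: i; j; k] ->
  act E s (rmon i u j v k) = rmon (s i) u (s j) v (s k).
Proof. by move=> ijk; rewrite act_lmon // (rot_uniq 1 [:: i; j; k]). Qed.

Lemma ternh_comp E F G (f : 'Hom(vecT K (gens E), vecT K (gens F)))
    (g : 'Hom(vecT K (gens F), vecT K (gens G))) :
  ternh (g \o f)%VF = (ternh g \o ternh f)%VF.
Proof. by rewrite /ternh !tensh_comp comp_lfun1l. Qed.

Lemma ternh1 E : ternh \1%VF = \1%VF :> 'End(vecT K (tern E)).
Proof. by rewrite /ternh !tensh1. Qed.

Lemma ternh_act E F (f : 'Hom(vecT K (gens E), vecT K (gens F))) s :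
  (f \o swap E = swap F \o f)%VF ->
  (ternh f \o act E s = act F s \o ternh f)%VF.
Proof.
move=> fS; rewrite /ternh /act !tensh_comp !comp_lfun1l !comp_lfun1r.
by case: (odd_perm s); rewrite ?fS ?comp_lfun1l ?comp_lfun1r.
Qed.

Lemma ternh_lmon E F (f : 'Hom(vecT K (gens E), vecT K (gens F))) i j k u v :
  (f \o swap E = swap F \o f)%VF ->
  ternh f (lmon i v j u k) = lmon i (f v) j (f u) k.
Proof.
move=> fS; rewrite /lmon /tree !tensh_tens id_lfunE; congr tens.
by case: ifP => // _; rewrite -!comp_lfunE fS.
Qed.

Lemma ternh_rmon E F (f : 'Hom(vecT K (gens E), vecT K (gens F))) i j k u v :
  (f \o swap E = swap F \o f)%VF ->
  ternh f (rmon i u j v k) = rmon i (f u) j (f v) k.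
Proof.
by move=> fS; rewrite ternh_lmon // -comp_lfunE fS comp_lfunE.
Qed.

End Ternary.


(* A finitely generated binary quadratic operad O = F(E)/(R), given by its
   quadratic data: the S_2-module E = O(2) of generators, and the S_3-submodule
   R of F(E)(3) of relations, so that O(3) = F(E)(3)/R. *)
Record bqop (K : fieldType) := BQOp {
  op2 :> s2mod K;
  rels : {vspace vecT K (tern op2)};
  rel_stable : forall s, (act op2 s @: rels <= rels)%VS }.

(* A morphism F(E)/(R) -> F(E')/(R') of operads is determined by its arity 2
   component E -> E', which may be any S_2-equivariant map sending R to R'. *)
Record bqhom (K : fieldType) (O P : bqop K) := BQHom {
  hmap :> 'Hom(vecT K (gens O), vecT K (gens P));
  hmap_swap : (hmap \o swap O = swap P \o hmap)%VF;
  hmap_rel : (ternh hmap @: rels O <= rels P)%VS }.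

Section Category.
Variable K : fieldType.
Implicit Types O P Q : bqop K.

Lemma bqhom_eq O P (f g : bqhom O P) : hmap f = hmap g -> f = g.
Proof.
case: f g => [f fS fR] [g gS gR] /= fg; rewrite -fg in gS gR *.
by rewrite (eq_irrelevance gS fS) (bool_irrelevance gR fR).
Qed.

Fact bqid_swap O : (\1 \o swap O = swap O \o \1)%VF.
Proof. by rewrite comp_lfun1l comp_lfun1r. Qed.

Fact bqid_rel O : (@ternh K O O \1%VF @: rels O <= rels O)%VS.
Proof. by rewrite ternh1 lim1g. Qed.

Definition bqid O : bqhom O O := BQHom (bqid_swap O) (bqid_rel O).

Fact bqcomp_swap O P Q (g : bqhom P Q) (f : bqhom O P) :
  ((g \o f) \o swap O = swap Q \o (g \o f))%VF.
Proof. by rewrite -comp_lfunA hmap_swap !comp_lfunA hmap_swap. Qed.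

Fact bqcomp_rel O P Q (g : bqhom P Q) (f : bqhom O P) :
  (ternh (g \o f)%VF @: rels O <= rels Q)%VS.
Proof.
rewrite ternh_comp limg_comp.
exact: subv_trans (limgS _ (hmap_rel f)) (hmap_rel g).
Qed.

Definition bqcomp O P Q (g : bqhom P Q) (f : bqhom O P) : bqhom O Q :=
  BQHom (bqcomp_swap g f) (bqcomp_rel g f).

Record bqiso O P := BQIso {
  iso_to :> bqhom O P;
  iso_inv : bqhom P O;
  iso_toK : bqcomp iso_inv iso_to = bqid O;
  iso_invK : bqcomp iso_to iso_inv = bqid P }.

End Category.

Section WhiteProduct.
Variable K : fieldType.
Implicit Types E F : s2mod K.
Implicit Types O P : bqop K.

Fact tens_swapK E F :
  (tensh (swap E) (swap F) \o tensh (swap E) (swap F) = \1)%VF.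
Proof. by rewrite tensh_comp !swapK tensh1. Qed.

Definition s2tens E F : s2mod K := S2Mod (tens_swapK E F).

(* The map F(E (x) F)(3) -> F(E)(3) (x) F(F)(3) which evaluates the tensor
   product operations (u (x) v)(a (x) b, a' (x) b') = u(a, a') (x) v(b, b'). *)
Definition tern_tens E F :
    'Hom(vecT K (tern (s2tens E F)), vecT K (tern E * tern F)%type) :=
  linext (fun p => tens (tree p.1.1 (bas K p.1.2.1) (bas K p.2.1))
                        (tree p.1.1 (bas K p.1.2.2) (bas K p.2.2))).

(* An endomorphism of F(O(2))(3) with kernel [rels O], hence with image
   isomorphic to O(3): the quotient map F(O(2))(3) -> O(3). *)
Definition ar3 O : 'End(vecT K (tern O)) := (\1 - projv (rels O))%VF.

Definition white_rel O P : {vspace vecT K (tern (s2tens O P))} :=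
  lker (tensh (ar3 O) (ar3 P) \o tern_tens O P)%VF.

Lemma tern_tens_tree E F k (u v : vec K (gens E)) (u' v' : vec K (gens F)) :
  tern_tens E F (@tree K (s2tens E F) k (tens u u') (tens v v')) =
  tens (tree k u v) (tree k u' v').
Proof.
apply/ffunP => -[[[a i] j] [[b i'] j']]; rewrite linextE sum_ffunE.
rewrite (bigD1 (a, (i, i'), (j, j'))) //= big1 => [|[[c [l l']] [m m']]] /=.
  rewrite addr0 /tree !tens_bas !ffunE /= !xpair_eqE !eqxx !andbT /=.
  have [->|/negPf ab] := eqVneq b a.
    case: (a == k); last by rewrite !mul0r; exact: mul0r.
    by rewrite !mul1r -[RHS]mulr1 mulrACA; congr (_ * _).
  case: eqVneq => [<-|_]; first by rewrite ab !mul0r mulr0; exact: mulr0.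
  by rewrite !mul0r; exact: mul0r.
move=> np; rewrite /tree !tens_bas ffunE basE; case: eqP => [e|_].
  by case: e np => -> -> -> _ -> ->; rewrite eqxx.
exact: mulr0.
Qed.

Lemma bas_tree E F k i i' j j' :
  bas K ((k, (i, i')), (j, j')) =
  @tree K (s2tens E F) k (tens (bas K i) (bas K i')) (tens (bas K j) (bas K j')).
Proof. by rewrite /tree !tens_bas. Qed.

Lemma tern_tens_act E F s :
  (tern_tens E F \o act (s2tens E F) s =
   tensh (act E s) (act F s) \o tern_tens E F)%VF.
Proof.
apply: lfun_bas_eq => -[[k [i i']] [j j']].
rewrite !comp_lfunE bas_tree.
rewrite (@act_tree K (s2tens E F)) tern_tens_tree tensh_tens !act_tree.
by case: (odd_perm s); rewrite ?tensh_tens tern_tens_tree.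
Qed.

Lemma tern_tens_ternh E F E' F' (f : 'Hom(vecT K (gens E), vecT K (gens E')))
    (g : 'Hom(vecT K (gens F), vecT K (gens F'))) :
  (tern_tens E' F' \o @ternh K (s2tens E F) (s2tens E' F') (tensh f g) =
   tensh (ternh f) (ternh g) \o tern_tens E F)%VF.
Proof.
apply: lfun_bas_eq => -[[k [i i']] [j j']].
rewrite !comp_lfunE bas_tree.
rewrite tern_tens_tree /ternh /tree !tensh_tens id_lfunE.
exact: (@tern_tens_tree E' F').
Qed.

Lemma ar3E O v : ar3 O v = v - projv (rels O) v.
Proof. by rewrite add_lfunE opp_lfunE id_lfunE. Qed.

Lemma ar3_ker O : lker (ar3 O) = rels O.
Proof.
apply/vspaceP => v; rewrite memv_ker ar3E subr_eq0.
apply/eqP/idP => [->|/projv_id ->//]; exact: memv_proj.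
Qed.

Lemma ar3_factor O P (f : 'Hom(vecT K (tern O), vecT K (tern P))) :
  (f @: rels O <= rels P)%VS -> (ar3 P \o f = ar3 P \o f \o ar3 O)%VF.
Proof.
move=> fR; apply/lfunP => v; rewrite !comp_lfunE [ar3 O v]ar3E !linearB /=.
rewrite (_ : ar3 P (f (projv (rels O) v)) = 0) ?subr0 //.
apply/eqP; rewrite -memv_ker ar3_ker; apply: (subvP fR).
exact/memv_img/memv_proj.
Qed.

Fact white_rel_stable O P s :
  (act (s2tens O P) s @: white_rel O P <= white_rel O P)%VS.
Proof.
apply/subvP => _ /memv_imgP[v vR ->]; move: vR; rewrite !memv_ker -!comp_lfunE.
rewrite -comp_lfunA tern_tens_act comp_lfunA tensh_comp.
rewrite (ar3_factor (@rel_stable K O s)) (ar3_factor (@rel_stable K P s)).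
rewrite -tensh_comp -comp_lfunA => /eqP vR.
by rewrite comp_lfunE vR linear0.
Qed.

Definition white O P : bqop K := BQOp (@white_rel_stable O P).

Fact whiteh_swap O P O' P' (f : bqhom O O') (g : bqhom P P') :
  (tensh f g \o swap (white O P) = swap (white O' P') \o tensh f g)%VF.
Proof. by rewrite !tensh_comp !hmap_swap. Qed.

Fact whiteh_rel O P O' P' (f : bqhom O O') (g : bqhom P P') :
  (@ternh K (white O P) (white O' P') (tensh f g) @: rels (white O P)
     <= rels (white O' P'))%VS.
Proof.
apply/subvP => _ /memv_imgP[v vR ->]; move: vR; rewrite !memv_ker -!comp_lfunE.
rewrite -comp_lfunA tern_tens_ternh comp_lfunA tensh_comp.
rewrite (ar3_factor (hmap_rel f)) (ar3_factor (hmap_rel g)).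
rewrite -tensh_comp -comp_lfunA => /eqP vR.
by rewrite comp_lfunE vR linear0.
Qed.

Definition whiteh O P O' P' (f : bqhom O O') (g : bqhom P P') :
    bqhom (white O P) (white O' P') :=
  @BQHom K (white O P) (white O' P') _ (whiteh_swap f g) (whiteh_rel f g).

Lemma whiteh_id O P : whiteh (bqid O) (bqid P) = bqid (white O P).
Proof. by apply: bqhom_eq; exact: tensh1. Qed.

Lemma whiteh_comp O P O' P' O'' P'' (f : bqhom O O') (g : bqhom P P')
    (f' : bqhom O' O'') (g' : bqhom P' P'') :
  whiteh (bqcomp f' f) (bqcomp g' g) = bqcomp (whiteh f' g') (whiteh f g).
Proof. by apply: bqhom_eq; rewrite /= tensh_comp. Qed.

End WhiteProduct.

Section KoszulDual.
Variable K : fieldType.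
Implicit Types E : s2mod K.
Implicit Types O P Q : bqop K.

Fact dual_swapK E : ((- transp (swap E)) \o (- transp (swap E)) = \1)%VF.
Proof.
by rewrite comp_lfunNl comp_lfunNr opprK -transp_comp swapK transp_id.
Qed.

(* The dual of E twisted by the sign character. *)
Definition s2dual E : s2mod K := S2Mod (dual_swapK E).

Lemma act_dual E s :
  act (s2dual E) s = (-1) ^+ odd_perm s *: transp (act E s^-1%g).
Proof.
have relabelV : transp (relabel K s^-1) = relabel K s.
  apply: lfun_bas_eq => j; rewrite !linext_bas; apply/ffunP => i.
  by rewrite ffunE linext_bas !basE [i == _]eq_sym (canF_eq (permK s)).
rewrite /act !transp_tensh relabelV transp_id odd_permV.
by case: (odd_perm s); rewrite ?scale1r ?scaleN1r ?tenshNr ?transp_id.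
Qed.

Fact dual_rel_stable O s :
  (act (s2dual O) s @: annihilator (rels O) <= annihilator (rels O))%VS.
Proof.
apply/subvP => _ /memv_imgP[v /annihilatorP vR ->].
rewrite act_dual scale_lfunE; apply/memvZ/annihilatorP => u uR.
rewrite pairingC -pairing_transp pairingC; apply: vR.
by apply: (subvP (rel_stable O s^-1%g)); apply: memv_img.
Qed.

(* The dual of F(E)(3) twisted by the sign character is F(s2dual E)(3), via the
   pairing <tree k a b, tree l u v> = a(u) b(v) if k = l, and 0 otherwise; the
   Koszul dual operad is generated by s2dual E subject to the annihilator of
   the relations. *)
Definition koszul_dual O : bqop K := BQOp (@dual_rel_stable O).

Fact dualh_swap O P (f : bqhom O P) :
  (transp f \o swap (koszul_dual P) = swap (koszul_dual O) \o transp f)%VF.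
Proof. by rewrite comp_lfunNr comp_lfunNl -!transp_comp (hmap_swap f). Qed.

Fact dualh_rel O P (f : bqhom O P) :
  (@ternh K (koszul_dual P) (koszul_dual O) (transp f)
     @: rels (koszul_dual P) <= rels (koszul_dual O))%VS.
Proof.
apply/subvP => _ /memv_imgP[v /annihilatorP vR ->]; apply/annihilatorP => u uR.
rewrite /ternh -[\1%VF]transp_id -!transp_tensh.
rewrite pairingC -pairing_transp pairingC; apply: vR.
by apply: (subvP (hmap_rel f)); apply: memv_img.
Qed.

Definition dualh O P (f : bqhom O P) : bqhom (koszul_dual P) (koszul_dual O) :=
  @BQHom K (koszul_dual P) (koszul_dual O) _ (dualh_swap f) (dualh_rel f).

Lemma dualh_id O : dualh (bqid O) = bqid (koszul_dual O).
Proof. by apply: bqhom_eq; exact: transp_id. Qed.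

Lemma dualh_comp O P Q (g : bqhom P Q) (f : bqhom O P) :
  dualh (bqcomp g f) = bqcomp (dualh f) (dualh g).
Proof. by apply: bqhom_eq; exact: transp_comp. Qed.

Definition black O P : bqop K :=
  koszul_dual (white (koszul_dual O) (koszul_dual P)).

Definition blackh O P O' P' (f : bqhom O O') (g : bqhom P P') :
    bqhom (black O P) (black O' P') :=
  dualh (whiteh (dualh f) (dualh g)).

Lemma blackh_id O P : blackh (bqid O) (bqid P) = bqid (black O P).
Proof. by rewrite /blackh !dualh_id whiteh_id dualh_id. Qed.

Lemma blackh_comp O P O' P' O'' P'' (f : bqhom O O') (g : bqhom P P')
    (f' : bqhom O' O'') (g' : bqhom P' P'') :
  blackh (bqcomp f' f) (bqcomp g' g) = bqcomp (blackh f' g') (blackh f g).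
Proof. by rewrite /blackh !dualh_comp whiteh_comp dualh_comp. Qed.

End KoszulDual.

Section Presentations.
Variable K : fieldType.
Implicit Types E : s2mod K.
Implicit Types T : finType.

Definition pres_rel E (rs : seq (vec K (tern E))) : {vspace vecT K (tern E)} :=
  (\sum_(s : 'S_3) (act E s @: <<rs>>))%VS.

Fact pres_rel_stable E rs s : (act E s @: pres_rel rs <= pres_rel rs)%VS.
Proof.
rewrite limg_sum; apply/subv_sumP => t _; rewrite -limg_comp act_comp.
exact: (sumv_sup (t * s)%g).
Qed.

(* The operad generated by E subject to the relations rs, which are imposed
   for all permutations of the variables. *)
Definition pres E (rs : seq (vec K (tern E))) : bqop K :=
  BQOp (@pres_rel_stable E rs).

Fact sgn_swapK : ((- \1) \o (- \1) = \1 :> 'End(vecT K unit))%VF.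
Proof. by rewrite comp_lfunNl comp_lfunNr opprK comp_lfun1l. Qed.

(* One commutative, respectively anticommutative, generator. *)
Definition s2triv : s2mod K := S2Mod (comp_lfun1l (\1 : 'End(vecT K unit))%VF).
Definition s2sgn : s2mod K := S2Mod sgn_swapK.

Definition flip (T : finType) : 'End(vecT K (T * bool)%type) :=
  linext (fun p => bas K (p.1, ~~ p.2)).

Fact flipK (T : finType) : (flip T \o flip T = \1)%VF.
Proof.
apply: lfun_bas_eq => -[t b].
by rewrite comp_lfunE !linext_bas id_lfunE /= negbK.
Qed.

(* Generators without symmetry: (t, false) is the operation t, and (t, true)
   is its opposite. *)
Definition s2free (T : finType) : s2mod K := S2Mod (flipK T).

Definition op (T : finType) (t : T) : vec K (gens (s2free T)) :=
  bas K (t, false).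

Definition freeh (T : finType) E (f : T -> vec K (gens E)) :
    'Hom(vecT K (gens (s2free T)), vecT K (gens E)) :=
  linext (fun p => if p.2 then swap E (f p.1) else f p.1).

Lemma swapKE E u : swap E (swap E u) = u.
Proof. by rewrite -comp_lfunE swapK id_lfunE. Qed.

Lemma freeh_op T E (f : T -> vec K (gens E)) t : freeh f (op t) = f t.
Proof. exact: linext_bas. Qed.

Fact freeh_swap T E (f : T -> vec K (gens E)) :
  (freeh f \o swap (s2free T) = swap E \o freeh f)%VF.
Proof.
apply: lfun_bas_eq => -[t b]; rewrite !comp_lfunE /= !linext_bas /=.
by case: b; rewrite //= swapKE.
Qed.

Lemma mem_pres E rs r s : r \in rs -> act E s r \in rels (pres rs).
Proof.
move=> rrs; apply: (subvP (sumv_sup s _ (subvv _))) => //.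
exact/memv_img/memv_span.
Qed.

Lemma pres_hom_rel E rs (P : bqop K) (f : 'Hom(vecT K (gens E), vecT K (gens P))) :
  (f \o swap E = swap P \o f)%VF ->
  (forall r, r \in rs -> ternh f r \in rels P) ->
  (@ternh K (pres rs) P f @: rels (pres rs) <= rels P)%VS.
Proof.
move=> fS fR; rewrite limg_sum; apply/subv_sumP => s _.
rewrite -limg_comp (ternh_act s fS) limg_comp.
apply: subv_trans (rel_stable P s); apply: limgS; rewrite limg_span.
by apply/span_subvP => _ /mapP[r rrs ->]; apply: fR.
Qed.

Lemma perm3_ex (i j k : 'I_3) : uniq [:: i; j; k] ->
  exists s : 'S_3, [/\ s 0 = i, s 1 = j & s 2%:R = k].
Proof.
move=> ijk; pose f (t : 'I_3) := nth 0 [:: i; j; k] t.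
have fI : injective f.
  by move=> a b /eqP; rewrite nth_uniq // => /eqP; apply: val_inj.
by exists (perm fI); split; rewrite permE.
Qed.

Lemma mem_pres3 E rs (r : 'I_3 -> 'I_3 -> 'I_3 -> vec K (tern E)) i j k :
  r 0 1 2%:R \in rs -> uniq [:: i; j; k] ->
  (forall s : 'S_3, act E s (r 0 1 2%:R) = r (s 0) (s 1) (s 2%:R)) ->
  r i j k \in rels (pres rs).
Proof.
by move=> rrs /perm3_ex[s [<- <- <-]] rs3; rewrite -rs3; apply: mem_pres.
Qed.

Lemma treeBl E k u u' v : @tree K E k (u - u') v = tree k u v - tree k u' v.
Proof. by apply/ffunP => p; rewrite !ffunE; lazy beta; rewrite mulrBr mulrBl. Qed.

Lemma treeBr E k u v v' : @tree K E k u (v - v') = tree k u v - tree k u v'.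
Proof. by apply/ffunP => p; rewrite !ffunE; lazy beta; rewrite mulrBr. Qed.

Lemma lmonB1 E i j k (u v v' : vec K (gens E)) :
  lmon i (v - v') j u k = lmon i v j u k - lmon i v' j u k.
Proof. by rewrite /lmon -treeBr; case: ifP => // _; rewrite linearB. Qed.

Lemma lmonB2 E i j k (u u' v : vec K (gens E)) :
  lmon i v j (u - u') k = lmon i v j u k - lmon i v j u' k.
Proof. by rewrite /lmon -treeBl. Qed.

Lemma rmonB1 E i j k (u u' v : vec K (gens E)) :
  rmon i (u - u') j v k = rmon i u j v k - rmon i u' j v k.
Proof. by rewrite /rmon -lmonB2 linearB. Qed.

Lemma rmonB2 E i j k (u v v' : vec K (gens E)) :
  rmon i u j (v - v') k = rmon i u j v k - rmon i u j v' k.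
Proof. exact: lmonB1. Qed.

Lemma lmonS1 E i j k (u v : vec K (gens E)) : uniq [:: i; j; k] ->
  lmon i (swap E v) j u k = lmon j v i u k.
Proof.
move=> ijk; have e : (j == k + 1) = ~~ (i == k + 1).
  by move: i j k ijk; do 3! [elim/I3_cases].
by rewrite /lmon e; case: eqP => //= _; rewrite swapKE.
Qed.

Lemma lmonS2 E i j k (u v : vec K (gens E)) :
  lmon i v j (swap E u) k = rmon k u i v j.
Proof. by []. Qed.

Lemma rmonS1 E i j k (u v : vec K (gens E)) :
  rmon i (swap E u) j v k = lmon j v k u i.
Proof. by rewrite /rmon swapKE. Qed.

Lemma rmonS2 E i j k (u v : vec K (gens E)) : uniq [:: i; j; k] ->
  rmon i u j (swap E v) k = rmon i u k v j.
Proof. by move=> ijk; apply: lmonS1; rewrite (rot_uniq 1 [:: i; j; k]). Qed.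

End Presentations.

Section Operads.
Variable K : fieldType.

Local Notation F1 := (s2free K unit).
Local Notation F2 := (s2free K bool).

Local Notation x := (0 : 'I_3).
Local Notation y := (1 : 'I_3).
Local Notation z := (2%:R : 'I_3).

Definition Lie : bqop K :=
  let b := bas K tt : vec K (gens (s2sgn K)) in
  pres [:: lmon x b y b z + lmon y b z b x + lmon z b x b y].

Definition Com : bqop K :=
  let m := bas K tt : vec K (gens (s2triv K)) in
  pres [:: lmon x m y m z - rmon x m y m z].

Definition Ass : bqop K :=
  let m := op K tt in
  pres [:: lmon x m y m z - rmon x m y m z].

Definition preLie : bqop K :=
  let m := op K tt in
  pres [:: (lmon x m y m z - rmon x m y m z) -
           (lmon x m z m y - rmon x m z m y)].

Definition Zinb : bqop K :=
  let m := op K tt in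
  pres [:: lmon x m y m z - (rmon x m y m z + rmon x m z m y)].

Definition Leib : bqop K :=
  let m := op K tt in
  pres [:: lmon x m y m z - (rmon x m y m z + lmon x m z m y)].

Definition Perm : bqop K :=
  let m := op K tt in
  pres [:: lmon x m y m z - rmon x m y m z; rmon x m y m z - rmon x m z m y].

Local Notation prec := (op K false).
Local Notation succ := (op K true).

Definition Dend : bqop K :=
  pres [:: lmon x prec y prec z - (rmon x prec y prec z + rmon x prec y succ z);
           lmon x succ y prec z - rmon x succ y prec z;
           rmon x succ y succ z - (lmon x prec y succ z + lmon x succ y succ z)].

Definition diAss : bqop K :=
  pres [:: lmon x prec y prec z - rmon x prec y prec z;
           rmon x prec y prec z - rmon x prec y succ z;
           lmon x succ y prec z - rmon x succ y prec z;
           lmon x prec y succ z - lmon x succ y succ z;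
           lmon x succ y succ z - rmon x succ y succ z].

Definition Lie_Ass_map : 'Hom(vecT K (gens Lie), vecT K (gens Ass)) :=
  linext (fun=> op K tt - swap Ass (op K tt)).

Definition Ass_Com_map : 'Hom(vecT K (gens Ass), vecT K (gens Com)) :=
  freeh (fun=> bas K tt : vec K (gens (s2triv K))).

(* x . y is sent to x prec y - y succ x. *)
Definition dialg_map : 'Hom(vecT K (gens F1),
                            vecT K (gens F2)) :=
  freeh (fun=> prec - swap F2 succ).

(* x prec y is sent to x . y, and x succ y to y . x. *)
Definition codialg_map : 'Hom(vecT K (gens F2),
                              vecT K (gens F1)) :=
  freeh (fun b => if b then swap F1 (op K tt) else op K tt).

(* Closes linear identities between monomials. *)
Ltac monomial_ring :=
  rewrite ?/reverse_coercion; cbn [op2 Ass Zinb Perm Dend diAss pres];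
  repeat match goal with
  | |- context [@lmon ?F ?E ?a ?b ?c ?d ?e] =>
    generalize (@lmon F E a b c d e); intro
  | |- context [@rmon ?F ?E ?a ?b ?c ?d ?e] =>
    generalize (@rmon F E a b c d e); intro
  end;
  apply/ffunP => ?; rewrite !ffunE; ring.

Ltac mem_pres_tac r :=
  move=> ijk; apply: (@mem_pres3 K _ _ r) => // [|s];
  [by rewrite !inE eqxx ?orbT
  | by rewrite !(linearD, linearN) /= !(act_lmon, act_rmon)].

Let m := op K tt.

Lemma AssR i j k : uniq [:: i; j; k] ->
  lmon i m j m k - rmon i m j m k \in rels Ass.
Proof. mem_pres_tac (fun i j k => lmon i m j m k - rmon i m j m k). Qed.

Lemma ZinbR i j k : uniq [:: i; j; k] ->
  lmon i m j m k - (rmon i m j m k + rmon i m k m j) \in rels Zinb.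
Proof.
mem_pres_tac (fun i j k => lmon i m j m k - (rmon i m j m k + rmon i m k m j)).
Qed.

Lemma PermR1 i j k : uniq [:: i; j; k] ->
  lmon i m j m k - rmon i m j m k \in rels Perm.
Proof. mem_pres_tac (fun i j k => lmon i m j m k - rmon i m j m k). Qed.

Lemma PermR2 i j k : uniq [:: i; j; k] ->
  rmon i m j m k - rmon i m k m j \in rels Perm.
Proof. mem_pres_tac (fun i j k => rmon i m j m k - rmon i m k m j). Qed.

Lemma DendR1 i j k : uniq [:: i; j; k] ->
  lmon i prec j prec k - (rmon i prec j prec k + rmon i prec j succ k)
    \in rels Dend.
Proof.
mem_pres_tac (fun i j k => lmon i prec j prec k -
  (rmon i prec j prec k + rmon i prec j succ k)).
Qed.

Lemma DendR2 i j k : uniq [:: i; j; k] ->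
  lmon i succ j prec k - rmon i succ j prec k \in rels Dend.
Proof.
mem_pres_tac (fun i j k => lmon i succ j prec k - rmon i succ j prec k).
Qed.

Lemma DendR3 i j k : uniq [:: i; j; k] ->
  rmon i succ j succ k - (lmon i prec j succ k + lmon i succ j succ k)
    \in rels Dend.
Proof.
mem_pres_tac (fun i j k => rmon i succ j succ k -
  (lmon i prec j succ k + lmon i succ j succ k)).
Qed.

Lemma diAssR1 i j k : uniq [:: i; j; k] ->
  lmon i prec j prec k - rmon i prec j prec k \in rels diAss.
Proof.
mem_pres_tac (fun i j k => lmon i prec j prec k - rmon i prec j prec k).
Qed.

Lemma diAssR2 i j k : uniq [:: i; j; k] ->
  rmon i prec j prec k - rmon i prec j succ k \in rels diAss.
Proof.
mem_pres_tac (fun i j k => rmon i prec j prec k - rmon i prec j succ k).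
Qed.

Lemma diAssR3 i j k : uniq [:: i; j; k] ->
  lmon i succ j prec k - rmon i succ j prec k \in rels diAss.
Proof.
mem_pres_tac (fun i j k => lmon i succ j prec k - rmon i succ j prec k).
Qed.

Lemma diAssR4 i j k : uniq [:: i; j; k] ->
  lmon i prec j succ k - lmon i succ j succ k \in rels diAss.
Proof.
mem_pres_tac (fun i j k => lmon i prec j succ k - lmon i succ j succ k).
Qed.

Lemma diAssR5 i j k : uniq [:: i; j; k] ->
  lmon i succ j succ k - rmon i succ j succ k \in rels diAss.
Proof.
mem_pres_tac (fun i j k => lmon i succ j succ k - rmon i succ j succ k).
Qed.

Fact Lie_Ass_swap : (Lie_Ass_map \o swap Lie = swap Ass \o Lie_Ass_map)%VF.
Proof.
apply: lfun_bas_eq => t; rewrite !comp_lfunE opp_lfunE id_lfunE linearN /=.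
rewrite [Lie_Ass_map _]linext_bas opprB linearB; congr (_ - _).
exact/esym/(@swapKE K F1).
Qed.

Fact Lie_Ass_rel : (ternh Lie_Ass_map @: rels Lie <= rels Ass)%VS.
Proof.
have mE : Lie_Ass_map (bas K tt) = m - swap F1 m by exact: linext_bas.
apply: (pres_hom_rel Lie_Ass_swap) => r; rewrite inE => /eqP ->.
rewrite !linearD /= !(ternh_lmon _ _ _ _ _ Lie_Ass_swap) !mE.
rewrite !(lmonB1, lmonB2) !lmonS2 !(lmonS1, rmonS2) //.
set v := (X in X \in _).
have -> : v = (lmon x m y m z - rmon x m y m z) - (lmon y m x m z - rmon y m x m z)
  + (lmon y m z m x - rmon y m z m x) - (lmon z m y m x - rmon z m y m x)
  + (lmon z m x m y - rmon z m x m y) - (lmon x m z m y - rmon x m z m y).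
  by rewrite /v; monomial_ring.
by do ![exact: AssR | apply: rpredB | apply: rpredD].
Qed.

Definition Lie_Ass : bqhom Lie Ass := BQHom Lie_Ass_swap Lie_Ass_rel.

Fact Ass_Com_rel : (ternh Ass_Com_map @: rels Ass <= rels Com)%VS.
Proof.
have fS := freeh_swap (fun _ : unit => bas K tt : vec K (gens (s2triv K))).
apply: (pres_hom_rel (P := Com) fS) => r; rewrite inE => /eqP ->.
rewrite linearB /= (ternh_rmon _ _ _ _ _ fS) (ternh_lmon _ _ _ _ _ fS).
rewrite freeh_op -[X in X \in _]id_lfunE -(act1 (s2triv K)).
by apply: mem_pres; rewrite inE.
Qed.

Definition Ass_Com : bqhom Ass Com := @BQHom K Ass Com _ (freeh_swap _) Ass_Com_rel.

Let dialg_swap := freeh_swap (fun _ : unit => prec - swap F2 succ).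
Let dialgE : dialg_map m = prec - swap F2 succ.
Proof. exact: linext_bas. Qed.

Fact preLie_Dend_rel : (ternh dialg_map @: rels preLie <= rels Dend)%VS.
Proof.
apply: (pres_hom_rel (P := Dend) dialg_swap) => r; rewrite inE => /eqP ->.
rewrite !linearB /= !(ternh_rmon _ _ _ _ _ dialg_swap).
rewrite !(ternh_lmon _ _ _ _ _ dialg_swap) !dialgE.
rewrite !(lmonB1, lmonB2, rmonB1, rmonB2) !(lmonS2, rmonS1).
rewrite !(lmonS1, rmonS2) //.
set v := (X in X \in _).
pose D1 i j k := lmon i prec j prec k -
  (rmon i prec j prec k + rmon i prec j succ k).
pose D2 i j k := lmon i succ j prec k - rmon i succ j prec k.
pose D3 i j k := rmon i succ j succ k -
  (lmon i prec j succ k + lmon i succ j succ k).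
have -> : v = D1 x y z - D1 x z y - D2 y x z + D2 z x y + D3 z y x - D3 y z x.
  by rewrite /v /D1 /D2 /D3; monomial_ring.
apply: rpredB; last exact: DendR3.
apply: rpredD; last exact: DendR3.
apply: rpredD; last exact: DendR2.
apply: rpredB; last exact: DendR2.
by apply: rpredB; exact: DendR1.
Qed.

Definition preLie_Dend : bqhom preLie Dend :=
  @BQHom K preLie Dend _ dialg_swap preLie_Dend_rel.

Fact Leib_diAss_rel : (ternh dialg_map @: rels Leib <= rels diAss)%VS.
Proof.
apply: (pres_hom_rel (P := diAss) dialg_swap) => r; rewrite inE => /eqP ->.
rewrite !linearB /= linearD /= !(ternh_rmon _ _ _ _ _ dialg_swap).
rewrite !(ternh_lmon _ _ _ _ _ dialg_swap) !dialgE.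
rewrite !(lmonB1, lmonB2, rmonB1, rmonB2) !(lmonS2, rmonS1).
rewrite !(lmonS1, rmonS2) //.
set v := (X in X \in _).
pose A1 i j k := lmon i prec j prec k - rmon i prec j prec k.
pose A2 i j k := rmon i prec j prec k - rmon i prec j succ k.
pose A3 i j k := lmon i succ j prec k - rmon i succ j prec k.
pose A4 i j k := lmon i prec j succ k - lmon i succ j succ k.
pose A5 i j k := lmon i succ j succ k - rmon i succ j succ k.
have -> : v = A1 x y z - A3 y x z + A3 z x y - A5 z y x
              - A2 x z y - A1 x z y + A4 y z x + A5 y z x.
  by rewrite /v /A1 /A2 /A3 /A4 /A5; monomial_ring.
apply: rpredD; last exact: diAssR5.
apply: rpredD; last exact: diAssR4.
apply: rpredB; last exact: diAssR1.
apply: rpredB; last exact: diAssR2.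
apply: rpredB; last exact: diAssR5.
apply: rpredD; last exact: diAssR3.
by apply: rpredB; [exact: diAssR1 | exact: diAssR3].
Qed.

Definition Leib_diAss : bqhom Leib diAss :=
  @BQHom K Leib diAss _ dialg_swap Leib_diAss_rel.

Let codialg_swap :=
  freeh_swap (fun b => if b then swap F1 m else m).
Let codialgE0 : codialg_map prec = m. Proof. exact: linext_bas. Qed.
Let codialgE1 : codialg_map succ = swap F1 m.
Proof. exact: linext_bas. Qed.

Fact Dend_Zinb_rel : (ternh codialg_map @: rels Dend <= rels Zinb)%VS.
Proof.
pose Z i j k := lmon i m j m k - (rmon i m j m k + rmon i m k m j).
apply: (pres_hom_rel (P := Zinb) codialg_swap) => r.
rewrite !inE => /or3P[] /eqP ->;
  rewrite linearB ?linearD /= !(ternh_rmon _ _ _ _ _ codialg_swap)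
    !(ternh_lmon _ _ _ _ _ codialg_swap) ?codialgE0 ?codialgE1
    ?(lmonS2, rmonS1) ?(lmonS1, rmonS2) //; set v := (X in X \in _).
- have -> : v = Z x y z by rewrite /v /Z; monomial_ring.
  exact: ZinbR.
- have -> : v = Z y x z - Z y z x by rewrite /v /Z; monomial_ring.
  by apply: rpredB; apply: ZinbR.
- have -> : v = Z z y x by rewrite /v /Z; monomial_ring.
  exact: ZinbR.
Qed.

Definition Dend_Zinb : bqhom Dend Zinb :=
  @BQHom K Dend Zinb _ codialg_swap Dend_Zinb_rel.

Fact diAss_Perm_rel : (ternh codialg_map @: rels diAss <= rels Perm)%VS.
Proof.
pose P1 i j k := lmon i m j m k - rmon i m j m k.
pose P2 i j k := rmon i m j m k - rmon i m k m j.
apply: (pres_hom_rel (P := Perm) codialg_swap) => r.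
rewrite !inE => /or4P[/eqP->|/eqP->|/eqP->|/orP[]/eqP->];
  rewrite linearB /= ?(ternh_rmon _ _ _ _ _ codialg_swap)
    ?(ternh_lmon _ _ _ _ _ codialg_swap) ?codialgE0 ?codialgE1
    ?(lmonS2, rmonS1) ?(lmonS1, rmonS2) //; set v := (X in X \in _).
- exact: PermR1.
- exact: PermR2.
- have -> : v = P1 y x z + P2 y x z - P1 y z x.
    by rewrite /v /P1 /P2; monomial_ring.
  by apply: rpredB; [apply: rpredD|]; [exact: PermR1|exact: PermR2|exact: PermR1].
- exact: PermR2.
- have -> : v = - P1 z y x by rewrite /v /P1; monomial_ring.
  by apply: rpredNr; apply: PermR1.
Qed.

Definition diAss_Perm : bqhom diAss Perm :=
  @BQHom K diAss Perm _ codialg_swap diAss_Perm_rel.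

End Operads.

(* Main.v *)
From mathcomp Require Import fingroup perm ring.
Require Import Defs.
From mathcomp Require Import all_boot all_order all_algebra.

(** A binary quadratic operad is known once the kernel of the quotient map from
    the free operad F(E)(3) onto O(3) is known.  A _model_ of O is any linear
    map A from F(E)(3) to a coordinate space with lker A = rels O; it embeds
    O(3) into that space.  The models used are
    - Com(3): the line, every monomial being sent to the same vector;
    - Lie(3): the sum-zero vectors of K^3, [[x_i, x_j], x_k] being sent to
      e_i - e_j;
    - Ass(3), Zinb(3), Leib(3): the space spanned by the six words ijk, with
      concatenation for Ass and a half-shuffle for Zinb.

    Each kernel is computed in the same way ([section_model]): A kills the
    defining relations, and some map N satisfies t - N (A t) in rels O for each
    monomial t, so that N (A t) is a normal form of t which depends on the value
    of t only.

    The relations of a white product of O and P are the kernel of the tensor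
    product of any two models, evaluated on the tensor product operations
    ([white_model]).  With the generators b (x) m, resp. m (x) m and
    m (x) m^op, resp. c (x) m, for the products b of Lie, m of Ass or Zinb, and
    c of Com, this evaluation is a model of preLie, resp. Dend, resp. Zinb
    ([Lie_Zinb_evalP], [Ass_Zinb_evalP], [Com_Zinb_evalP]): this is the first
    row.  The squares commute because they do so on generators.

    The third row is the Koszul dual of the first.  The annihilator of a kernel
    is the image of the transpose, so the relations of the dual of P are the
    coordinates of a model of P, seen as functionals ([dual_model]).  When the
    generators have no symmetry, identifying them with the dual basis sends a
    monomial on x_i, x_j, x_k to its own dual vector, up to the signature of
    ijk and a sign that separates the two shapes of trees
    ([dual_tern_transp]).  So the relations of the dual can be read off
    the model of P, which gives isomorphisms
    - Com, Ass, Lie with the duals of Lie, Ass, Com;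
    - Zinb with the dual of Leib;
    - Leib, diAss, Perm with the duals of Zinb, Dend, preLie.
    They identify the second row with its own dual and the third row with the dual
    of the first, with all arrows reversed.  As a black product is the dual of
    the white product of the duals, the first row is carried to the third
    ([black_iso_square]). *)

Set Implicit Arguments.
Unset Strict Implicit.
Unset Printing Implicit Defensive.

Import GRing.Theory.
Local Open Scope ring_scope.

(** * The category of binary quadratic operads *)

Section Isomorphisms.
Variable K : fieldType.
Implicit Types O P Q : bqop K.

Lemma bqcompA O P Q S (h : bqhom Q S) (g : bqhom P Q) (f : bqhom O P) :
  bqcomp h (bqcomp g f) = bqcomp (bqcomp h g) f.
Proof. by apply: bqhom_eq; rewrite /= comp_lfunA. Qed.

Lemma bqcomp1l O P (f : bqhom O P) : bqcomp (bqid P) f = f.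
Proof. by apply: bqhom_eq; rewrite /= comp_lfun1l. Qed.

Lemma bqcomp1r O P (f : bqhom O P) : bqcomp f (bqid O) = f.
Proof. by apply: bqhom_eq; rewrite /= comp_lfun1r. Qed.

Fact inverse_swap O P (f : bqhom O P) (g : 'Hom(vecT K (gens P), vecT K (gens O))) :
  (f \o g = \1)%VF -> (g \o f = \1)%VF -> (g \o swap P = swap O \o g)%VF.
Proof.
move=> fg gf; rewrite -[LHS]comp_lfun1r -fg comp_lfunA -(comp_lfunA g) -hmap_swap.
by rewrite comp_lfunA gf comp_lfun1l.
Qed.

(** An isomorphism is a morphism whose linear inverse preserves the relations, as
    equivariance of the inverse is automatic. *)
Definition bqiso_of O P (f : bqhom O P) (g : 'Hom(vecT K (gens P), vecT K (gens O)))
    (fg : (f \o g = \1)%VF) (gf : (g \o f = \1)%VF)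
    (gR : (ternh g @: rels P <= rels O)%VS) : bqiso O P :=
  let g' := BQHom (inverse_swap fg gf) gR in
  @BQIso K O P f g' (@bqhom_eq K O O (bqcomp g' f) (bqid O) gf)
    (@bqhom_eq K P P (bqcomp f g') (bqid P) fg).

Definition bqiso_sym O P (i : bqiso O P) : bqiso P O :=
  BQIso (iso_invK i) (iso_toK i).

Fact bqiso_comp_K O P Q (g : bqiso P Q) (f : bqiso O P) :
  bqcomp (bqcomp (iso_inv f) (iso_inv g)) (bqcomp g f) = bqid O.
Proof.
by rewrite -bqcompA [X in bqcomp _ X]bqcompA iso_toK bqcomp1l iso_toK.
Qed.

Definition bqiso_comp O P Q (g : bqiso P Q) (f : bqiso O P) : bqiso O Q :=
  BQIso (bqiso_comp_K g f) (bqiso_comp_K (bqiso_sym f) (bqiso_sym g)).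

Fact whiteh_iso_K O P O' P' (f : bqiso O O') (g : bqiso P P') :
  bqcomp (whiteh (iso_inv f) (iso_inv g)) (whiteh f g) = bqid (white O P).
Proof. by rewrite -whiteh_comp !iso_toK whiteh_id. Qed.

Definition white_iso O P O' P' (f : bqiso O O') (g : bqiso P P') :
    bqiso (white O P) (white O' P') :=
  BQIso (whiteh_iso_K f g) (whiteh_iso_K (bqiso_sym f) (bqiso_sym g)).

Fact dualh_iso_K O P (f : bqiso O P) :
  bqcomp (dualh (iso_inv f)) (dualh f) = bqid (koszul_dual P).
Proof. by rewrite -dualh_comp iso_invK dualh_id. Qed.

Definition dual_iso O P (f : bqiso O P) : bqiso (koszul_dual P) (koszul_dual O) :=
  BQIso (dualh_iso_K f) (dualh_iso_K (bqiso_sym f)).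

(** Morphisms are easiest to define on free generators, so the isomorphisms below
    start at preLie, Dend and Zinb; this inverts the squares which they form. *)
Lemma bqiso_square O P O' P' (f : bqiso O O') (g : bqiso P P')
    (h : bqhom O P) (h' : bqhom O' P') :
  bqcomp g h = bqcomp h' f -> bqcomp (bqiso_sym g) h' = bqcomp h (bqiso_sym f).
Proof.
move=> gh; rewrite -[LHS]bqcomp1r -(iso_invK f) bqcompA -(bqcompA _ h') -gh.
by rewrite bqcompA iso_toK bqcomp1l.
Qed.

(** The elements [op t] and their opposites form a basis, and equivariance determines
    a morphism on the opposites. *)
Lemma free_bqhom_eq (T : finType) (rs : seq (vec K (tern (s2free K T)))) (P : bqop K)
    (f g : bqhom (pres rs) P) :
  (forall t, f (op K t) = g (op K t)) -> f = g.
Proof.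
move=> fg; apply/bqhom_eq/lfun_bas_eq => -[t []]; last exact: fg.
have -> : bas K (t, true) = swap (s2free K T) (op K t) by rewrite /= linext_bas.
have hS (h : bqhom (pres rs) P) v : h (swap (s2free K T) v) = swap P (h v).
  by have /lfunP/(_ v) := hmap_swap h; rewrite !comp_lfunE.
by rewrite !hS fg.
Qed.

End Isomorphisms.

(** * Models of the arity three component *)

Section Models.
Variable K : fieldType.
Implicit Types I J L : finType.
Implicit Types O P : bqop K.

Lemma limg_bas I (V : vectType K) (f : 'Hom(vecT K I, V)) (U : {vspace V}) :
  (forall i, f (bas K i) \in U) -> (limg f <= U)%VS.
Proof.
move=> fU; apply/subvP => _ /memv_imgP[v _ ->]; rewrite lfun_vec.
by apply: rpred_sum => i _; apply: rpredZ.
Qed.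

(** The partial inverse of f is a right inverse on the image of f, so that
    v - f^-1 (f v) lies in the kernel of f. *)
Lemma lker_factor I J L (f : 'Hom(vecT K I, vecT K J)) (g : 'Hom(vecT K I, vecT K L)) :
  (lker f <= lker g)%VS -> (g = g \o f^-1 \o f)%VF.
Proof.
move=> fg; apply/lfunP => v; apply/eqP; rewrite !comp_lfunE -subr_eq0 -linearB.
rewrite -memv_ker; apply: (subvP fg); rewrite memv_ker linearB /=.
by rewrite limg_lfunVK ?subrr // memv_img ?memvf.
Qed.

Lemma lker_tensh I J I1 J1 I2 J2
    (f : 'Hom(vecT K I, vecT K I1)) (f' : 'Hom(vecT K I, vecT K I2))
    (g : 'Hom(vecT K J, vecT K J1)) (g' : 'Hom(vecT K J, vecT K J2)) :
  (lker f <= lker f')%VS -> (lker g <= lker g')%VS ->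
  (lker (tensh f g) <= lker (tensh f' g'))%VS.
Proof.
move=> /lker_factor -> /lker_factor ->; rewrite -tensh_comp.
by apply/subvP => v; rewrite !memv_ker comp_lfunE => /eqP->; rewrite linear0.
Qed.

(** Only the kernels of the two maps to O(3) and P(3) matter, so the quotient maps
    can be replaced by any two models. *)
Lemma white_model O P I J (f : 'Hom(vecT K (tern O), vecT K I))
    (g : 'Hom(vecT K (tern P), vecT K J)) :
  lker f = rels O -> lker g = rels P ->
  rels (white O P) = lker (tensh f g \o tern_tens O P)%VF.
Proof.
move=> fR gR; apply/vspaceP => v; rewrite !memv_ker !comp_lfunE -!memv_ker.
move: (tern_tens O P v) => w; apply/idP/idP; apply/subvP/lker_tensh;
  by rewrite ?ar3_ker ?fR ?gR.
Qed.

Lemma pairing_bas I (v : vec K I) i : pairing v (bas K i) = v i.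
Proof. exact: linext_bas. Qed.

Lemma annihilator_lker I J (f : 'Hom(vecT K I, vecT K J)) :
  annihilator (lker f) = limg (transp f).
Proof.
apply/vspaceP => v; apply/annihilatorP/idP => [vf | /memv_imgP[w _ ->] u].
  have vE : v = transp f (transp f^-1%VF v).
    apply/ffunP => i; rewrite -!pairing_bas -!pairing_transp.
    apply/eqP; rewrite -subr_eq0 -linearB; apply/eqP.
    rewrite [LHS]pairingC vf // memv_ker linearB /= limg_lfunVK ?subrr //.
    by rewrite memv_img ?memvf.
  by rewrite vE memv_img ?memvf.
by rewrite memv_ker pairingC -pairing_transp => /eqP ->; rewrite linear0.
Qed.

(** The relations of the dual are the functionals on F(E)(3) which factor through
    P(3), i.e. which are combinations of coordinates of a model. *)
Lemma dual_model P J (f : 'Hom(vecT K (tern P), vecT K J)) :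
  lker f = rels P -> rels (koszul_dual P) = limg (transp f).
Proof. by move=> fR; rewrite -annihilator_lker fR. Qed.

Lemma pres_sub E (rs : seq (vec K (tern E))) (U : {vspace vecT K (tern E)}) :
  (forall r s, r \in rs -> act E s r \in U) -> (rels (pres rs) <= U)%VS.
Proof.
move=> rsU; apply/subv_sumP => s _; rewrite limg_span.
by apply/span_subvP => _ /mapP[r rrs ->]; apply: rsU.
Qed.

(** The map N returns normal forms: as t - N (A t) is a relation for each basis
    vector t, it is one for all t, and it is t itself if A t = 0. *)
Lemma section_model O J (A : 'Hom(vecT K (tern O), vecT K J))
    (N : 'Hom(vecT K J, vecT K (tern O))) :
  (rels O <= lker A)%VS ->
  (forall p, bas K p - N (A (bas K p)) \in rels O) ->
  lker A = rels O.
Proof.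
move=> OA ON; apply/eqP; rewrite eqEsubv OA andbT; apply/subvP => v.
rewrite memv_ker => /eqP Av.
have /subvP : (limg (\1 - (N \o A))%VF <= rels O)%VS.
  by apply: limg_bas => p; rewrite add_lfunE opp_lfunE comp_lfunE id_lfunE.
move=> /(_ _ (memv_img _ (memvf v))).
by rewrite add_lfunE opp_lfunE comp_lfunE id_lfunE Av linear0 subr0.
Qed.

End Models.

(** * Words and monomials in three variables *)

(** Once i is known, only the two orders of the remaining elements are left. *)
Lemma I3_uniq_ind (P : 'I_3 -> 'I_3 -> 'I_3 -> Prop) :
  (forall i, P i (i + 1) (i + 2%:R)) -> (forall i, P i (i + 2%:R) (i + 1)) ->
  forall i j k, uniq [:: i; j; k] -> P i j k.
Proof.
move=> P1 P2 i j k ijk.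
have [[-> ->]|[-> ->]] // : (j = i + 1 /\ k = i + 2%:R) \/ (j = i + 2%:R /\ k = i + 1).
move: i j k ijk; do 3! [elim/I3_cases] => //= _;
  by [left; split; apply: val_inj | right; split; apply: val_inj].
Qed.

Lemma I3_1neq2 (i : 'I_3) : (i + 2%:R == i + 1) = false.
Proof. by move: i; elim/I3_cases. Qed.

Lemma I3_uniq1 (i : 'I_3) : uniq [:: i; i + 1; i + 2%:R].
Proof. by move: i; elim/I3_cases. Qed.

Lemma I3_uniq2 (i : 'I_3) : uniq [:: i; i + 2%:R; i + 1].
Proof. by move: i; elim/I3_cases. Qed.

Lemma I3_uniqs (i j k : 'I_3) : uniq [:: i; j; k] ->
  [/\ uniq [:: i; k; j], uniq [:: j; i; k], uniq [:: j; k; i], uniq [:: k; i; j]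
    & uniq [:: k; j; i]].
Proof. by move: i j k; apply: I3_uniq_ind; elim/I3_cases. Qed.

Lemma I3_neq (i j k : 'I_3) : uniq [:: i; j; k] ->
  ((i == j) = false) * ((j == i) = false) * ((i == k) = false) *
  ((k == i) = false) * ((j == k) = false) * ((k == j) = false).
Proof.
rewrite /= !inE negb_or => /andP[/andP[/negPf ij /negPf ik] /andP[/negPf jk _]].
by rewrite ![_ == i]eq_sym [k == j]eq_sym.
Qed.

Lemma I3_parity (i j k : 'I_3) : uniq [:: i; j; k] ->
  ((j == k + 1) = ~~ (i == k + 1)) * ((i == j + 1) = ~~ (i == k + 1)) *
  ((k == j + 1) = (i == k + 1)) * ((j == i + 1) = (i == k + 1)) *
  ((k == i + 1) = ~~ (i == k + 1)).
Proof. by move: i j k; apply: I3_uniq_ind; elim/I3_cases. Qed.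

Lemma perm3_uniq (s : 'S_3) : uniq [:: s 0; s 1; s 2%:R].
Proof. exact: (map_inj_uniq (@perm_inj _ s) [:: 0; 1; 2%:R]). Qed.

(** Turns the image under a permutation of a relation between monomials in 0, 1, 2
    into the same relation between monomials in distinct variables i, j, k. *)
Ltac generic_permutation s :=
  rewrite !(linearD, linearN) /= ?act_rmon // ?act_lmon //;
  move: (perm3_uniq s); move: (s 0) (s 1) (s 2%:R); intros i j k ijk;
  have [ikj jik jki kij kji] := I3_uniqs ijk.

Section Words.
Variable K : fieldType.

Definition word : finType := ('I_3 * bool)%type.

(** The word ijk on three distinct letters is encoded by its first letter and its
    parity, so that every element of the index type is a word. *)
Definition wd (i j k : 'I_3) : word := (i, j == i + 1).

Definition word_fun (V : Type) (F : 'I_3 -> 'I_3 -> 'I_3 -> V) (w : word) : V :=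
  if w.2 then F w.1 (w.1 + 1) (w.1 + 2%:R) else F w.1 (w.1 + 2%:R) (w.1 + 1).

Definition wordh (V : vectType K) (F : 'I_3 -> 'I_3 -> 'I_3 -> V) :
    'Hom(vecT K word, V) :=
  linext (word_fun F).

Lemma word_fun_wd V F i j k : uniq [:: i; j; k] ->
  @word_fun V F (wd i j k) = F i j k.
Proof.
move: i j k; apply: I3_uniq_ind => i; rewrite /word_fun /wd /=.
  by rewrite eqxx.
by rewrite I3_1neq2.
Qed.

Lemma wordh_wd V F i j k : uniq [:: i; j; k] ->
  @wordh V F (bas K (wd i j k)) = F i j k.
Proof. by move=> ijk; rewrite linext_bas word_fun_wd. Qed.

Lemma wd_eq i j k i' j' k' : uniq [:: i; j; k] -> uniq [:: i'; j'; k'] ->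
  (wd i j k == wd i' j' k') = (i == i') && (j == j').
Proof.
move: i j k; apply: I3_uniq_ind => i; move: i' j' k'; apply: I3_uniq_ind => i';
  rewrite /wd xpair_eqE; (have [<-|//] := eqVneq i i') => {i'};
  by move: i; elim/I3_cases.
Qed.

Lemma word_ind (P : word -> Prop) :
  (forall i j k, uniq [:: i; j; k] -> P (wd i j k)) -> forall w, P w.
Proof.
move=> Pw [i []].
  by have := Pw _ _ _ (I3_uniq1 i); rewrite /wd eqxx.
by have := Pw _ _ _ (I3_uniq2 i); rewrite /wd I3_1neq2.
Qed.

Variable T : finType.
Local Notation E := (s2free K T).

(** The monomials (x_i v x_j) u x_k and x_i u (x_j v x_k) on the generators
    [op t], for distinct i, j, k, form a basis of F(E)(3) when E is free; this is
    the linear map with prescribed values L, R on them. *)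
Definition monh (V : vectType K) (L R : 'I_3 -> T -> 'I_3 -> T -> 'I_3 -> V) :
    'Hom(vecT K (tern E), V) :=
  linext (fun p : 'I_3 * (T * bool) * (T * bool) =>
    let: (k, (u, b), (v, c)) := p in
    let i := if c then k + 2%:R else k + 1 in
    let j := if c then k + 1 else k + 2%:R in
    if b then R k u i v j else L i v j u k).

Lemma monh_lmon V L R i v j u k : uniq [:: i; j; k] ->
  @monh V L R (lmon i (op K v) j (op K u) k) = L i v j u k.
Proof.
move=> ijk; have {ijk}: uniq [:: k; i; j] by rewrite (rot_uniq 2 [:: i; j; k]).
move: k i j; apply: I3_uniq_ind => k; rewrite /lmon /tree /op.
  by rewrite eqxx !tens_bas linext_bas.
by rewrite I3_1neq2 /= linext_bas !tens_bas linext_bas.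
Qed.

Lemma monh_rmon V L R i u j v k : uniq [:: i; j; k] ->
  @monh V L R (rmon i (op K u) j (op K v) k) = R i u j v k.
Proof.
move: i j k; apply: I3_uniq_ind => k; rewrite /rmon /lmon /tree /op.
  by rewrite eqxx /= linext_bas !tens_bas linext_bas.
by rewrite I3_1neq2 /= !linext_bas !tens_bas linext_bas.
Qed.

Lemma mon_ind (P : vec K (tern E) -> Prop) :
  (forall i v j u k, uniq [:: i; j; k] -> P (lmon i (op K v) j (op K u) k)) ->
  (forall i u j v k, uniq [:: i; j; k] -> P (rmon i (op K u) j (op K v) k)) ->
  forall p, P (bas K p).
Proof.
move=> PL PR [[k [u b]] [v c]].
have [u1 u2] := (I3_uniq1 k, I3_uniq2 k).
case: b.
  have := PR k u (if c then k + 2%:R else k + 1) v (if c then k + 1 else k + 2%:R).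
  rewrite /rmon /lmon /tree /op /= linext_bas !tens_bas.
  by case: c; rewrite ?eqxx ?I3_1neq2 ?linext_bas !tens_bas; apply.
have := PL (if c then k + 2%:R else k + 1) v (if c then k + 1 else k + 2%:R) u k.
rewrite /rmon /lmon /tree /op /= !tens_bas.
case: c; rewrite ?eqxx ?I3_1neq2 /= ?linext_bas !tens_bas; apply;
  by move: (k); elim/I3_cases.
Qed.

Lemma free_model (rs : seq (vec K (tern E))) (J : finType)
    (A : 'Hom(vecT K (tern E), vecT K J)) (N : 'Hom(vecT K J, vecT K (tern E))) :
  (rels (pres rs) <= lker A)%VS ->
  (forall i v j u k, uniq [:: i; j; k] ->
     lmon i (op K v) j (op K u) k - N (A (lmon i (op K v) j (op K u) k)) \in rels (pres rs)) ->
  (forall i u j v k, uniq [:: i; j; k] ->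
     rmon i (op K u) j (op K v) k - N (A (rmon i (op K u) j (op K v) k)) \in rels (pres rs)) ->
  lker A = rels (pres rs).
Proof.
move=> sA NL NR; apply: (@section_model K (pres rs) _ _ N) => // p.
exact: (mon_ind (P := fun t => t - N (A t) \in rels (pres rs))).
Qed.

End Words.

(** * Com, Lie, Ass, Zinb and Leib in arity three *)

Section OperadModels.
Variable K : fieldType.

Local Notation x := (0 : 'I_3).
Local Notation y := (1 : 'I_3).
Local Notation z := (2%:R : 'I_3).
Local Notation m := (op K tt).
Local Notation w i j k := (bas K (wd i j k)).

Definition Ass_model : 'Hom(vecT K (tern (Ass K)), vecT K word) :=
  monh (fun i _ j _ k => w i j k) (fun i _ j _ k => w i j k).

(** The words are the monomials x_i (x_j x_k), and (x_i x_j) x_k is the sum of the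
    words which start with i and shuffle j with k. *)
Definition Zinb_model : 'Hom(vecT K (tern (Zinb K)), vecT K word) :=
  monh (fun i _ j _ k => w i j k + w i k j) (fun i _ j _ k => w i j k).

(** The words are the left-normed monomials (x_i x_j) x_k. *)
Definition Leib_model : 'Hom(vecT K (tern (Leib K)), vecT K word) :=
  monh (fun i _ j _ k => w i j k) (fun i _ j _ k => w i j k - w i k j).

Lemma Ass_model_lmon i j k : uniq [:: i; j; k] ->
  Ass_model (lmon i m j m k) = w i j k.
Proof. exact: monh_lmon. Qed.

Lemma Ass_model_rmon i j k : uniq [:: i; j; k] ->
  Ass_model (rmon i m j m k) = w i j k.
Proof. exact: monh_rmon. Qed.

Lemma Zinb_model_lmon i j k : uniq [:: i; j; k] ->
  Zinb_model (lmon i m j m k) = w i j k + w i k j.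
Proof. exact: monh_lmon. Qed.

Lemma Zinb_model_rmon i j k : uniq [:: i; j; k] ->
  Zinb_model (rmon i m j m k) = w i j k.
Proof. exact: monh_rmon. Qed.

Lemma Leib_model_lmon i j k : uniq [:: i; j; k] ->
  Leib_model (lmon i m j m k) = w i j k.
Proof. exact: monh_lmon. Qed.

Lemma Leib_model_rmon i j k : uniq [:: i; j; k] ->
  Leib_model (rmon i m j m k) = w i j k - w i k j.
Proof. exact: monh_rmon. Qed.

Lemma Ass_modelP : lker Ass_model = rels (Ass K).
Proof.
apply: (@free_model K _ _ _ _ (wordh (fun i j k => lmon i m j m k))).
  apply: pres_sub => r s; rewrite inE => /eqP ->.
  generic_permutation s; rewrite memv_ker; apply/eqP.
  by rewrite linearB /= monh_lmon ?monh_rmon // subrr.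
all: move=> i [] j [] k ijk; rewrite ?monh_lmon ?monh_rmon // wordh_wd //.
  by rewrite subrr mem0v.
by rewrite -opprB rpredN AssR.
Qed.

Lemma Zinb_modelP : lker Zinb_model = rels (Zinb K).
Proof.
apply: (@free_model K _ _ _ _ (wordh (fun i j k => rmon i m j m k))).
  apply: pres_sub => r s; rewrite inE => /eqP ->.
  generic_permutation s; rewrite memv_ker; apply/eqP.
  by rewrite !(linearD, linearN) /= monh_lmon ?monh_rmon // -opprD subrr.
all: move=> i [] j [] k ijk; have [ikj jik jki kij kji] := I3_uniqs ijk;
  rewrite ?monh_lmon ?monh_rmon // ?[wordh _ (_ + _)]linearD /= !wordh_wd //.
  exact: ZinbR.
by rewrite subrr mem0v.
Qed.

Lemma LeibR i j k : uniq [:: i; j; k] ->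
  lmon i m j m k - (rmon i m j m k + lmon i m k m j) \in rels (Leib K).
Proof.
move=> ijk; apply: (@mem_pres3 K _ _ (fun i j k => lmon i m j m k -
  (rmon i m j m k + lmon i m k m j))) => // [|s]; first by rewrite inE.
by rewrite !(linearD, linearN) /= ?act_rmon // ?act_lmon.
Qed.

Lemma Leib_modelP : lker Leib_model = rels (Leib K).
Proof.
apply: (@free_model K _ _ _ _ (wordh (fun i j k => lmon i m j m k))).
  apply: pres_sub => r s; rewrite inE => /eqP ->.
  generic_permutation s; rewrite memv_ker; apply/eqP.
  rewrite !(linearD, linearN) /= !monh_lmon ?monh_rmon //.
  by rewrite -opprD subrK subrr.
all: move=> i [] j [] k ijk; have [ikj jik jki kij kji] := I3_uniqs ijk;
  rewrite ?monh_lmon ?monh_rmon // ?[wordh _ (_ - _)]linearB /= !wordh_wd //.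
  by rewrite subrr mem0v.
rewrite -opprB -addrA -opprD [_ + rmon _ _ _ _ _]addrC.
by rewrite rpredN LeibR.
Qed.

Local Notation c := (bas K tt : vec K (gens (s2triv K))).
Local Notation b := (bas K tt : vec K (gens (s2sgn K))).

Definition Com_model : 'Hom(vecT K (tern (Com K)), vecT K unit) :=
  linext (fun=> bas K tt).

(** The basis vector of index k is the bracket [[x_(k+1), x_(k+2)], x_k]; the three
    values e_(k+1) - e_(k+2) have their sum as only linear relation, which is the
    Jacobi identity, in all characteristics. *)
Definition Lie_model : 'Hom(vecT K (tern (Lie K)), vecT K 'I_3) :=
  linext (fun p : 'I_3 * unit * unit => bas K (p.1.1 + 1) - bas K (p.1.1 + 2%:R)).

Lemma Com_model_tree k : Com_model (tree k c c) = bas K tt.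
Proof. by rewrite /tree !tens_bas linext_bas. Qed.

Lemma Com_lmon i j k : lmon i c j c k = tree k c c.
Proof. by rewrite /lmon /= id_lfunE if_same. Qed.

Lemma Com_rmon i j k : rmon i c j c k = tree i c c.
Proof. by rewrite /rmon /= id_lfunE Com_lmon. Qed.

Lemma Lie_model_lmon i j k : uniq [:: i; j; k] ->
  Lie_model (lmon i b j b k) = bas K i - bas K j.
Proof.
move=> ijk; have {ijk}: uniq [:: k; i; j] by rewrite (rot_uniq 2 [:: i; j; k]).
move: k i j; apply: I3_uniq_ind => k; rewrite /lmon /tree.
  by rewrite eqxx !tens_bas linext_bas.
rewrite I3_1neq2 /= opp_lfunE id_lfunE -[RHS]opprB.
have -> : tens (tens (bas K k) b) (- b) = - tens (tens (bas K k) b) b.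
  by apply/ffunP => p; rewrite !ffunE; lazy beta; rewrite mulrN.
by rewrite linearN /= !tens_bas linext_bas.
Qed.

Lemma Lie_model_rmon i j k : uniq [:: i; j; k] ->
  Lie_model (rmon i b j b k) = bas K k - bas K j.
Proof.
move=> ijk; have [ikj jik jki kij kji] := I3_uniqs ijk.
have -> : rmon i b j b k = - lmon j b k b i.
  rewrite /rmon /lmon /= !opp_lfunE !id_lfunE; apply/ffunP => p.
  by rewrite !ffunE; lazy beta; rewrite mulrN mulNr.
by rewrite linearN /= Lie_model_lmon // opprB.
Qed.

Lemma ComR i k : tree k c c - tree i c c \in rels (Com K).
Proof.
have [-> | ik] := eqVneq k i; first by rewrite subrr mem0v.
have [j ijk] : exists j, uniq [:: i; j; k].
  (* The three elements of Z/3 have sum 0. *)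
  exists (- i - k); move: i k ik; do 2! elim/I3_cases => //.
rewrite -(Com_lmon i j k) -(Com_rmon i j k).
apply: (@mem_pres3 K _ _ (fun i j k => lmon i c j c k - rmon i c j c k)) => // [|s].
  by rewrite inE.
by rewrite linearB /= act_rmon ?act_lmon.
Qed.

Lemma Com_modelP : lker Com_model = rels (Com K).
Proof.
apply: (@section_model K (Com K) _ _ (linext (fun=> tree 0 c c))).
  apply: pres_sub => r s; rewrite inE => /eqP ->.
  generic_permutation s; rewrite memv_ker; apply/eqP.
  by rewrite linearB /= Com_lmon Com_rmon !Com_model_tree subrr.
move=> [[k []] []]; have -> : bas K (k, tt, tt) = tree k c c by rewrite /tree !tens_bas.
by rewrite Com_model_tree linext_bas ComR.
Qed.

Lemma Lie_modelP : lker Lie_model = rels (Lie K).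
Proof.
(* A sum-zero vector is determined by its coordinates at e_1 and e_2, so e_0 may be
   sent to 0. *)
apply: (@section_model K (Lie K) _ _ (linext (fun i =>
   if i == y then - lmon x b y b z else if i == z then lmon z b x b y else 0))).
  apply: pres_sub => r s; rewrite inE => /eqP ->.
  generic_permutation s; rewrite memv_ker; apply/eqP.
  rewrite !linearD /= !Lie_model_lmon ?(rot_uniq 1 [:: i; j; k]) ?(rot_uniq 2 [:: i; j; k]) //.
  by rewrite [X in X + _]addrA subrK addrA subrK subrr.
have t_bas (i j k : 'I_3) : i == k + 1 -> bas K (k, tt, tt) = lmon i b j b k.
  by move=> ik; rewrite /lmon ik /tree !tens_bas.
move=> [[k []] []]; move: k; elim/I3_cases.
- rewrite (t_bas y z x) // Lie_model_lmon // linearB /= !linext_bas /=.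
  rewrite -opprD opprK addrA [_ + lmon x b y b z]addrC.
  rewrite -[X in X \in _]id_lfunE -(act1 (s2sgn K)).
  by apply: (@mem_pres _ (s2sgn K)); rewrite inE.
- by rewrite (t_bas z x y) // Lie_model_lmon // linearB /= !linext_bas /= subr0 subrr mem0v.
- rewrite (t_bas x y z) // Lie_model_lmon // linearB /= !linext_bas /=.
  by rewrite sub0r opprK subrr mem0v.
Qed.

End OperadModels.

(** * Evaluation of tensor product operations *)

Section Tensors.
Variable K : fieldType.

Lemma tensDl (I J : finType) (u u' : vec K I) (v : vec K J) :
  tens (u + u') v = tens u v + tens u' v.
Proof. by apply/ffunP => p; rewrite !ffunE; exact: mulrDl. Qed.

Lemma tensDr (I J : finType) (u : vec K I) (v v' : vec K J) :
  tens u (v + v') = tens u v + tens u v'.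
Proof. by apply/ffunP => p; rewrite !ffunE; exact: mulrDr. Qed.

Lemma tensNl (I J : finType) (u : vec K I) (v : vec K J) :
  tens (- u) v = - tens u v.
Proof. by apply/ffunP => p; rewrite !ffunE; exact: mulNr. Qed.

Lemma tensBl (I J : finType) (u u' : vec K I) (v : vec K J) :
  tens (u - u') v = tens u v - tens u' v.
Proof. by rewrite tensDl tensNl. Qed.

Lemma tern_tens_lmon (E F : s2mod K) i v v' j u u' k :
  tern_tens E F (@lmon K (s2tens E F) i (tens v v') j (tens u u') k) =
  tens (lmon i v j u k) (lmon i v' j u' k).
Proof.
by rewrite /lmon; case: ifP => _; rewrite /= ?tensh_tens tern_tens_tree.
Qed.

Lemma tern_tens_rmon (E F : s2mod K) i v v' j u u' k :
  tern_tens E F (@rmon K (s2tens E F) i (tens u u') j (tens v v') k) =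
  tens (rmon i u j v k) (rmon i u' j v' k).
Proof. by rewrite /rmon /= tensh_tens tern_tens_lmon. Qed.

Section Generators.
Variables (O P : bqop K) (T I J : finType).
Variables (p : T -> vec K (gens O)) (q : T -> vec K (gens P)).
Variables (A : 'Hom(vecT K (tern O), vecT K I)) (B : 'Hom(vecT K (tern P), vecT K J)).

Definition white_gens : 'Hom(vecT K (gens (s2free K T)), vecT K (gens (white O P))) :=
  freeh (E := white O P) (fun t => tens (p t) (q t)).

Lemma white_gens_swap :
  (white_gens \o swap (s2free K T) = swap (white O P) \o white_gens)%VF.
Proof. exact: freeh_swap. Qed.

Lemma white_gens_op t : white_gens (op K t) = tens (p t) (q t).
Proof. exact: freeh_op. Qed.

Lemma white_gens_opS t :
  white_gens (swap (s2free K T) (op K t)) = tens (swap O (p t)) (swap P (q t)).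
Proof. by rewrite -comp_lfunE white_gens_swap comp_lfunE white_gens_op tensh_tens. Qed.

(** If A and B are models of O and P, the kernel consists of the relations between
    the operations p t (x) q t in the white product. *)
Definition white_eval : 'Hom(vecT K (tern (s2free K T)), vecT K (I * J)%type) :=
  ((tensh A B \o tern_tens O P) \o @ternh K (s2free K T) (white O P) white_gens)%VF.

Lemma white_eval_lmon i v j u k :
  white_eval (lmon i (op K v) j (op K u) k) =
  tens (A (lmon i (p v) j (p u) k)) (B (lmon i (q v) j (q u) k)).
Proof.
rewrite /white_eval !comp_lfunE (ternh_lmon _ _ _ _ _ white_gens_swap) !freeh_op.
by rewrite tern_tens_lmon tensh_tens.
Qed.

Lemma white_eval_rmon i u j v k :
  white_eval (rmon i (op K u) j (op K v) k) =
  tens (A (rmon i (p u) j (p v) k)) (B (rmon i (q u) j (q v) k)).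
Proof.
rewrite /white_eval !comp_lfunE (ternh_rmon _ _ _ _ _ white_gens_swap) !freeh_op.
by rewrite tern_tens_rmon tensh_tens.
Qed.

End Generators.

Section ModelIso.
Variables (Q W : bqop K) (J : finType).
Variable A : 'Hom(vecT K (tern W), vecT K J).
Variables (f : 'Hom(vecT K (gens Q), vecT K (gens W)))
          (g : 'Hom(vecT K (gens W), vecT K (gens Q))).
Hypothesis fS : (f \o swap Q = swap W \o f)%VF.
Hypothesis fg : (f \o g = \1)%VF.
Hypothesis gf : (g \o f = \1)%VF.
Hypothesis AW : rels W = lker A.
Hypothesis AQ : lker (A \o ternh f)%VF = rels Q.

Fact model_hom_rel : (ternh f @: rels Q <= rels W)%VS.
Proof.
apply/subvP => _ /memv_imgP[v vR ->]; move: vR.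
by rewrite -AQ AW !memv_ker comp_lfunE.
Qed.

Fact model_inv_rel : (ternh g @: rels W <= rels Q)%VS.
Proof.
apply/subvP => _ /memv_imgP[v vR ->]; move: vR.
by rewrite -AQ AW !memv_ker !comp_lfunE -[ternh f _]comp_lfunE -ternh_comp fg ternh1 id_lfunE.
Qed.

(** The kernel of A o ternh f is the inverse image of the relations of W, so f and its
    inverse both preserve the relations. *)
Definition model_iso : bqiso Q W :=
  @bqiso_of K Q W (BQHom fS model_hom_rel) g fg gf model_inv_rel.

End ModelIso.

End Tensors.

(** * White products with Zinb *)

Section WhiteProducts.
Variable K : fieldType.

Local Notation m := (op K tt).
Local Notation w i j k := (bas K (wd i j k)).
Local Notation c := (bas K tt : vec K (gens (s2triv K))).
Local Notation b := (bas K tt : vec K (gens (s2sgn K))).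
Local Notation e i := (bas K (i : 'I_3)).
Local Notation prec := (op K false).
Local Notation succ := (op K true).
Local Notation Com_Zinb_eval :=
  (@white_eval K (Com K) (Zinb K) unit _ _ (fun=> c) (fun=> m)
     (Com_model K) (Zinb_model K)).
Local Notation Ass_Zinb_eval :=
  (@white_eval K (Ass K) (Zinb K) bool _ _ (fun=> m)
     (fun t : bool => if t then swap (Zinb K) m else m)
     (Ass_model K) (Zinb_model K)).
Local Notation Lie_Zinb_eval :=
  (@white_eval K (Lie K) (Zinb K) unit _ _ (fun=> b) (fun=> m)
     (Lie_model K) (Zinb_model K)).

Lemma Com_Zinb_lmon i j k : uniq [:: i; j; k] ->
  Com_Zinb_eval (lmon i m j m k) = tens (bas K tt) (w i j k + w i k j).
Proof.
by move=> ijk; rewrite white_eval_lmon Zinb_model_lmon // Com_lmon Com_model_tree.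
Qed.

Lemma Com_Zinb_rmon i j k : uniq [:: i; j; k] ->
  Com_Zinb_eval (rmon i m j m k) = tens (bas K tt) (w i j k).
Proof.
by move=> ijk; rewrite white_eval_rmon Zinb_model_rmon // Com_rmon Com_model_tree.
Qed.

Lemma Com_Zinb_evalP : lker Com_Zinb_eval = rels (Zinb K).
Proof.
apply: (@free_model K _ _ _ _
  (linext (fun p : unit * word => word_fun (fun i j k => rmon i m j m k) p.2))).
  apply: pres_sub => r s; rewrite inE => /eqP ->.
  generic_permutation s; rewrite memv_ker; apply/eqP.
  by rewrite !(linearD, linearN) /= Com_Zinb_lmon // !Com_Zinb_rmon // tensDr -opprD subrr.
all: move=> i [] j [] k ijk; have [ikj jik jki kij kji] := I3_uniqs ijk;
  rewrite ?Com_Zinb_lmon ?Com_Zinb_rmon //.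
  rewrite tensDr !tens_bas [linext _ (_ + _)]linearD /= !linext_bas !word_fun_wd //.
  exact: ZinbR.
by rewrite tens_bas linext_bas /= word_fun_wd // subrr mem0v.
Qed.

Lemma Ass_Zinb_prec_prec i j k : uniq [:: i; j; k] ->
  (Ass_Zinb_eval (lmon i prec j prec k) = tens (w i j k) (w i j k + w i k j)) *
  (Ass_Zinb_eval (rmon i prec j prec k) = tens (w i j k) (w i j k)).
Proof.
move=> ijk; have [ikj jik jki kij kji] := I3_uniqs ijk.
rewrite white_eval_lmon white_eval_rmon Ass_model_lmon // Ass_model_rmon //.
by rewrite Zinb_model_lmon // Zinb_model_rmon.
Qed.

Lemma Ass_Zinb_succ_prec i j k : uniq [:: i; j; k] ->
  (Ass_Zinb_eval (lmon i succ j prec k) = tens (w i j k) (w j i k + w j k i)) *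
  (Ass_Zinb_eval (rmon i succ j prec k) = tens (w i j k) (w j k i + w j i k)).
Proof.
move=> ijk; have [ikj jik jki kij kji] := I3_uniqs ijk.
rewrite white_eval_lmon white_eval_rmon Ass_model_lmon // Ass_model_rmon //.
by rewrite lmonS1 // rmonS1 !Zinb_model_lmon.
Qed.

Lemma Ass_Zinb_prec_succ i j k : uniq [:: i; j; k] ->
  (Ass_Zinb_eval (lmon i prec j succ k) = tens (w i j k) (w k i j)) *
  (Ass_Zinb_eval (rmon i prec j succ k) = tens (w i j k) (w i k j)).
Proof.
move=> ijk; have [ikj jik jki kij kji] := I3_uniqs ijk.
rewrite white_eval_lmon white_eval_rmon Ass_model_lmon // Ass_model_rmon //.
by rewrite lmonS2 rmonS2 // !Zinb_model_rmon.
Qed.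

Lemma Ass_Zinb_succ_succ i j k : uniq [:: i; j; k] ->
  (Ass_Zinb_eval (lmon i succ j succ k) = tens (w i j k) (w k j i)) *
  (Ass_Zinb_eval (rmon i succ j succ k) = tens (w i j k) (w k j i + w k i j)).
Proof.
move=> ijk; have [ikj jik jki kij kji] := I3_uniqs ijk.
rewrite white_eval_lmon white_eval_rmon Ass_model_lmon // Ass_model_rmon //.
by rewrite lmonS1 // rmonS1 lmonS2 lmonS1 // Zinb_model_rmon // Zinb_model_lmon.
Qed.

Definition Ass_ZinbE i j k (ijk : uniq [:: i; j; k]) :=
  (Ass_Zinb_prec_prec ijk, Ass_Zinb_succ_prec ijk,
   Ass_Zinb_prec_succ ijk, Ass_Zinb_succ_succ ijk).

(** Each word ijk of Ass meets eight monomials of Dend, with five normal forms, whose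
    values are ijk, ikj, jik + jki, kij and kji.  The coordinates at jik and jki are
    thus always equal, and the second one is ignored. *)
Definition Dend_normal : 'Hom(vecT K (word * word)%type, vecT K (tern (Dend K))) :=
  linext (fun p : word * word => word_fun (fun i j k =>
    if p.2 == wd i j k then rmon i prec j prec k
    else if p.2 == wd i k j then rmon i prec j succ k
    else if p.2 == wd j i k then rmon i succ j prec k
    else if p.2 == wd k i j then lmon i prec j succ k
    else if p.2 == wd k j i then lmon i succ j succ k
    else 0) p.1).

Lemma Dend_normalE i j k : uniq [:: i; j; k] ->
  ((Dend_normal (tens (w i j k) (w i j k)) = rmon i prec j prec k) *
   (Dend_normal (tens (w i j k) (w i k j)) = rmon i prec j succ k) *
   (Dend_normal (tens (w i j k) (w j i k)) = rmon i succ j prec k) *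
   (Dend_normal (tens (w i j k) (w j k i)) = 0) *
   (Dend_normal (tens (w i j k) (w k i j)) = lmon i prec j succ k) *
   (Dend_normal (tens (w i j k) (w k j i)) = lmon i succ j succ k))%type.
Proof.
move=> ijk; have [ikj jik jki kij kji] := I3_uniqs ijk.
rewrite !tens_bas !linext_bas !word_fun_wd //=; do !rewrite wd_eq //.
by rewrite !eqxx !(I3_neq ijk).
Qed.

Lemma Ass_Zinb_evalP : lker Ass_Zinb_eval = rels (Dend K).
Proof.
apply: (@free_model K _ _ _ _ Dend_normal).
  apply: pres_sub => r s; rewrite !inE => /or3P[] /eqP ->;
    generic_permutation s; rewrite memv_ker; apply/eqP;
    rewrite !(linearD, linearN) /=;
    rewrite !(Ass_Zinb_prec_prec, Ass_Zinb_succ_prec, Ass_Zinb_prec_succ,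
              Ass_Zinb_succ_succ) // ?tensDr.
  - by rewrite -opprD subrr.
  - by rewrite [X in _ - X]addrC subrr.
  - by rewrite -opprD [X in _ - X]addrC subrr.
all: move=> i [] j [] k ijk; have [ikj jik jki kij kji] := I3_uniqs ijk;
    rewrite !(Ass_Zinb_prec_prec, Ass_Zinb_succ_prec, Ass_Zinb_prec_succ,
              Ass_Zinb_succ_succ) // ?tensDr ?[Dend_normal (_ + _)]linearD /=
            !Dend_normalE // ?addr0 ?add0r ?subrr ?mem0v //.
- exact: DendR2.
- exact: DendR1.
- by rewrite [X in _ - X]addrC; exact: DendR3.
Qed.

Lemma Lie_Zinb_lmon i j k : uniq [:: i; j; k] ->
  Lie_Zinb_eval (lmon i m j m k) = tens (e i - e j) (w i j k + w i k j).
Proof.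
by move=> ijk; rewrite white_eval_lmon Zinb_model_lmon // Lie_model_lmon.
Qed.

Lemma Lie_Zinb_rmon i j k : uniq [:: i; j; k] ->
  Lie_Zinb_eval (rmon i m j m k) = tens (e k - e j) (w i j k).
Proof.
by move=> ijk; rewrite white_eval_rmon Zinb_model_rmon // Lie_model_rmon.
Qed.

Lemma preLieR i j k : uniq [:: i; j; k] ->
  (lmon i m j m k - rmon i m j m k) - (lmon i m k m j - rmon i m k m j) \in
    rels (preLie K).
Proof.
move=> ijk; apply: (@mem_pres3 K _ _ (fun i j k =>
  (lmon i m j m k - rmon i m j m k) - (lmon i m k m j - rmon i m k m j)))
  => // [|s]; first by rewrite inE.
by rewrite !(linearD, linearN) /= ?act_rmon // ?act_lmon.
Qed.

(** Modulo preLie relations, lmon i j k - rmon i j k is symmetric in j and k, and the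
    coordinates of its value at e_i (x) ijk and e_i (x) ikj are both 1.  The test on
    j keeps one of the two, as taking the mean would fail in characteristic 2. *)
Definition preLie_normal : 'Hom(vecT K ('I_3 * word)%type, vecT K (tern (preLie K))) :=
  linext (fun p : 'I_3 * word => word_fun (fun i j k =>
    if p.1 == i then if j == i + 1 then lmon i m j m k - rmon i m j m k else 0
    else if p.1 == j then - rmon i m j m k
    else 0) p.2).

Lemma preLie_normalE i j k : uniq [:: i; j; k] ->
  ((preLie_normal (tens (e i) (w i j k)) =
      if j == i + 1 then lmon i m j m k - rmon i m j m k else 0) *
   (preLie_normal (tens (e j) (w i j k)) = - rmon i m j m k) *
   (preLie_normal (tens (e k) (w i j k)) = 0)).
Proof.
move=> ijk; rewrite !tens_bas !linext_bas !word_fun_wd //= !eqxx.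
by rewrite !(I3_neq ijk).
Qed.

Lemma Lie_Zinb_evalP : lker Lie_Zinb_eval = rels (preLie K).
Proof.
apply: (@free_model K _ _ _ _ preLie_normal).
  apply: pres_sub => r s; rewrite !inE => /eqP ->.
  generic_permutation s; rewrite memv_ker; apply/eqP.
  rewrite !(linearD, linearN) /= !Lie_Zinb_lmon // !Lie_Zinb_rmon //.
  by apply/ffunP => p; rewrite !ffunE; lazy beta; ring.
all: move=> i [] j [] k ijk; have [ikj jik jki kij kji] := I3_uniqs ijk;
  rewrite ?Lie_Zinb_lmon ?Lie_Zinb_rmon //.
  rewrite tensDr !tensBl [preLie_normal (_ + _)]linearD /=.
  rewrite ![preLie_normal (_ - _)]linearB /= !preLie_normalE // opprK subr0.
  have -> : (k == i + 1) = ~~ (j == i + 1).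
    by move: (i) (j) (k) ijk; apply: I3_uniq_ind; elim/I3_cases.
  case: ifP => _ /=; first by rewrite addr0 subrK subrr mem0v.
  by rewrite add0r opprD addrA preLieR.
rewrite tensBl [preLie_normal (_ - _)]linearB /= !preLie_normalE //.
by rewrite opprK add0r subrr mem0v.
Qed.

Lemma flip_op (T : finType) (t : T) : flip K T (op K t) = bas K (t, true).
Proof. exact: linext_bas. Qed.

Lemma swap_op (T : finType) (t : T) : swap (s2free K T) (op K t) = bas K (t, true).
Proof. exact: flip_op. Qed.

Local Notation Com_Zinb_gens :=
  (@white_gens K (Com K) (Zinb K) unit (fun=> c) (fun=> m)).
Local Notation Ass_Zinb_gens :=
  (@white_gens K (Ass K) (Zinb K) bool (fun=> m)
     (fun t => if t then swap (Zinb K) m else m)).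
Local Notation Lie_Zinb_gens :=
  (@white_gens K (Lie K) (Zinb K) unit (fun=> b) (fun=> m)).

Definition Com_Zinb_inv :
    'Hom(vecT K (gens (white (Com K) (Zinb K))), vecT K (gens (Zinb K))) :=
  linext (fun p : unit * (unit * bool) => bas K p.2).

(** A basis vector of the source is a pair of products of Ass and of Zinb, each
    possibly reversed: it is succ or its opposite iff exactly one of them is
    reversed, and it is an opposite iff the product of Ass is reversed. *)
Definition Ass_Zinb_inv :
    'Hom(vecT K (gens (white (Ass K) (Zinb K))), vecT K (gens (Dend K))) :=
  linext (fun p : (unit * bool) * (unit * bool) => bas K (p.1.2 (+) p.2.2, p.1.2)).

(** The bracket is antisymmetric, so the opposite of b (x) m is - b (x) m^op. *)
Definition Lie_Zinb_inv :
    'Hom(vecT K (gens (white (Lie K) (Zinb K))), vecT K (gens (preLie K))) :=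
  linext (fun p : unit * (unit * bool) => (-1) ^+ p.2.2 *: bas K p.2).

Fact Com_Zinb_gensK : (Com_Zinb_inv \o Com_Zinb_gens = \1)%VF.
Proof.
apply: lfun_bas_eq => -[[] s]; rewrite comp_lfunE linext_bas /= !tensh_tens.
by rewrite !id_lfunE flip_op !tens_bas; case: s; rewrite linext_bas.
Qed.

Fact Com_Zinb_invK : (Com_Zinb_gens \o Com_Zinb_inv = \1)%VF.
Proof.
apply: lfun_bas_eq => -[[] [[] s]]; rewrite comp_lfunE !linext_bas /= !tensh_tens.
by rewrite !id_lfunE flip_op !tens_bas; case: s.
Qed.

Fact Ass_Zinb_gensK : (Ass_Zinb_inv \o Ass_Zinb_gens = \1)%VF.
Proof.
apply: lfun_bas_eq => -[t s]; rewrite comp_lfunE linext_bas /= !tensh_tens.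
rewrite id_lfunE; case: t; case: s; rewrite ?flip_op ?[flip _ _ (bas _ _)]linext_bas !tens_bas;
by rewrite linext_bas.
Qed.

Fact Ass_Zinb_invK : (Ass_Zinb_gens \o Ass_Zinb_inv = \1)%VF.
Proof.
apply: lfun_bas_eq => -[[[] s] [[] t]]; rewrite comp_lfunE !linext_bas /= !tensh_tens.
by rewrite id_lfunE; case: s; case: t;
  rewrite /= ?flip_op ?[flip _ _ (bas _ _)]linext_bas !tens_bas.
Qed.

Fact Lie_Zinb_gensK : (Lie_Zinb_inv \o Lie_Zinb_gens = \1)%VF.
Proof.
apply: lfun_bas_eq => -[[] s]; rewrite comp_lfunE linext_bas /= !tensh_tens.
rewrite opp_lfunE !id_lfunE tensNl flip_op !tens_bas.
by case: s; rewrite ?linearN /= !linext_bas /= ?scaleN1r ?scale1r ?opprK.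
Qed.

Fact Lie_Zinb_invK : (Lie_Zinb_gens \o Lie_Zinb_inv = \1)%VF.
Proof.
apply: lfun_bas_eq => -[[] [[] s]].
rewrite comp_lfunE !linext_bas linearZ /= !linext_bas /= !tensh_tens.
rewrite opp_lfunE !id_lfunE tensNl flip_op !tens_bas.
by case: s; rewrite /= ?scaleN1r ?scale1r ?opprK.
Qed.

Definition Com_Zinb_iso : bqiso (Zinb K) (white (Com K) (Zinb K)) :=
  @model_iso K (Zinb K) (white (Com K) (Zinb K)) _ _ Com_Zinb_gens Com_Zinb_inv
    (white_gens_swap _ _) Com_Zinb_invK Com_Zinb_gensK
    (white_model (Com_modelP K) (Zinb_modelP K)) Com_Zinb_evalP.

Definition Ass_Zinb_iso : bqiso (Dend K) (white (Ass K) (Zinb K)) :=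
  @model_iso K (Dend K) (white (Ass K) (Zinb K)) _ _ Ass_Zinb_gens Ass_Zinb_inv
    (white_gens_swap _ _) Ass_Zinb_invK Ass_Zinb_gensK
    (white_model (Ass_modelP K) (Zinb_modelP K)) Ass_Zinb_evalP.

Definition Lie_Zinb_iso : bqiso (preLie K) (white (Lie K) (Zinb K)) :=
  @model_iso K (preLie K) (white (Lie K) (Zinb K)) _ _ Lie_Zinb_gens Lie_Zinb_inv
    (white_gens_swap _ _) Lie_Zinb_invK Lie_Zinb_gensK
    (white_model (Lie_modelP K) (Zinb_modelP K)) Lie_Zinb_evalP.

Lemma Lie_Ass_Zinb_square :
  bqcomp Ass_Zinb_iso (preLie_Dend K) =
  bqcomp (whiteh (Lie_Ass K) (bqid (Zinb K))) Lie_Zinb_iso.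
Proof.
apply: free_bqhom_eq => -[]; rewrite [LHS]comp_lfunE [RHS]comp_lfunE.
transitivity (Ass_Zinb_gens prec - Ass_Zinb_gens (swap (s2free K bool) succ)).
  by rewrite -linearB; congr (Ass_Zinb_gens _); exact: freeh_op.
transitivity (tensh (Lie_Ass_map K) \1%VF (tens b m)); last first.
  congr (tensh _ _ _).
  exact: (esym (@white_gens_op K (Lie K) (Zinb K) unit (fun=> b) (fun=> m) tt)).
rewrite white_gens_op white_gens_opS.
rewrite tensh_tens id_lfunE [Lie_Ass_map K _]linext_bas tensBl; congr (_ - tens _ _).
exact: (@swapKE K (s2free K unit)).
Qed.

Lemma Ass_Com_Zinb_square :
  bqcomp Com_Zinb_iso (Dend_Zinb K) =
  bqcomp (whiteh (Ass_Com K) (bqid (Zinb K))) Ass_Zinb_iso.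
Proof.
apply: free_bqhom_eq => t; rewrite [LHS]comp_lfunE [RHS]comp_lfunE.
transitivity (Com_Zinb_gens (if t then swap (s2free K unit) m else m)).
  by congr (Com_Zinb_gens _); exact: freeh_op.
transitivity (tensh (Ass_Com_map K) \1%VF (Ass_Zinb_gens (op K t))); last by [].
rewrite white_gens_op tensh_tens freeh_op id_lfunE.
by case: t; rewrite ?white_gens_opS ?white_gens_op /= ?id_lfunE.
Qed.

End WhiteProducts.

(** * Koszul duality for generators without symmetry *)

Section FreeDual.
Variables (K : fieldType) (T : finType).
Local Notation E := (s2free K T).

(** The dual of the swap is twisted by a sign, so the opposite of the dual vector of
    [op t] is minus the dual vector of the opposite of [op t]. *)
Definition dual_gens : 'Hom(vecT K (gens E), vecT K (gens (s2dual E))) :=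
  linext (fun p : T * bool => (-1) ^+ p.2 *: bas K p).

Lemma dual_gens_swap : (dual_gens \o swap E = swap (s2dual E) \o dual_gens)%VF.
Proof.
apply: lfun_bas_eq => -[t b]; rewrite !comp_lfunE !linext_bas opp_lfunE linearZ /=.
rewrite linext_bas -scalerN; have -> : [ffun i => flip K T (bas K i) (t, b)] = bas K (t, ~~ b).
  apply/ffunP => -[t' b']; rewrite ffunE linext_bas !basE !xpair_eqE /= eq_sym.
  by case: b; case: b'.
by case: b; rewrite /= ?scaleN1r ?scale1r ?opprK.
Qed.

Lemma dual_gensK : (dual_gens \o dual_gens = \1 :> 'End(vecT K (T * bool)%type))%VF.
Proof.
apply: lfun_bas_eq => -[t b]; rewrite comp_lfunE linext_bas linearZ /= linext_bas.
by rewrite id_lfunE /= scalerA -expr2 sqrr_sign scale1r.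
Qed.

Lemma dual_gens_op t : dual_gens (op K t) = op K t.
Proof. by rewrite /op /dual_gens linext_bas expr0 scale1r. Qed.

Lemma dual_gens_opS t : dual_gens (swap E (op K t)) = - swap E (op K t).
Proof. by rewrite swap_op /dual_gens linext_bas expr1 scaleN1r. Qed.

(** The free operads on E and on its dual have the same index type in arity three, so
    this is typed as an endomorphism, which is an involution. *)
Definition dual_tern : 'Hom(vecT K (tern E), vecT K (tern E)) :=
  @ternh K E (s2dual E) dual_gens.

Lemma dual_ternK v : dual_tern (dual_tern v) = v.
Proof.
by rewrite -comp_lfunE -(@ternh_comp K E (s2dual E) E) dual_gensK ternh1 id_lfunE.
Qed.

Lemma dual_tern_bas k u b v c :
  dual_tern (bas K (k, (u, b), (v, c))) = (-1) ^+ (b (+) c) *: bas K (k, (u, b), (v, c)).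
Proof.
have -> : bas K (k, (u, b), (v, c)) = tens (tens (bas K k) (bas K (u, b))) (bas K (v, c)).
  by rewrite !tens_bas.
rewrite /dual_tern /ternh !tensh_tens id_lfunE !linext_bas.
apply/ffunP => p; rewrite !ffunE signr_addb; lazy beta.
rewrite /GRing.scale /=; ring.
Qed.

Lemma lmon_bas (i : 'I_3) v (j : 'I_3) u (k : 'I_3) : uniq [:: i; j; k] ->
  lmon i (op K v) j (op K u) k = @bas K (tern E) ((k, (u, false)), (v, i != k + 1)).
Proof.
move=> ijk; rewrite /lmon /tree /op; case: (i == k + 1); rewrite /= ?linext_bas !tens_bas //.
Qed.

Lemma rmon_bas (i : 'I_3) u (j : 'I_3) v (k : 'I_3) : uniq [:: i; j; k] ->
  rmon i (op K u) j (op K v) k = @bas K (tern E) ((i, (u, true)), (v, j != i + 1)).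
Proof.
move=> ijk; rewrite /rmon /lmon /tree /op; case: (j == i + 1);
  by rewrite /= !linext_bas !tens_bas.
Qed.

Lemma pair_sum (V : nmodType) (I J : finType) (G : I * J -> V) :
  \sum_p G p = \sum_i \sum_j G (i, j).
Proof. by rewrite pair_bigA; apply: eq_bigr => -[]. Qed.

Lemma I3_sum (V : nmodType) (F : 'I_3 -> bool -> V) i j k : uniq [:: i; j; k] ->
  \sum_l \sum_c F l c =
    (F k (i != k + 1) + F k (i == k + 1)) + (F j (i == k + 1) + F j (i != k + 1))
    + (F i (i != k + 1) + F i (i == k + 1)).
Proof.
move=> ijk; transitivity (\sum_(l <- [:: k; j; i]) \sum_c F l c).
  apply/perm_big/uniq_perm; first exact: index_enum_uniq.
    by have [] := I3_uniqs ijk.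
  move=> l; rewrite mem_index_enum; move: i j k ijk l.
  by apply: I3_uniq_ind; elim/I3_cases; elim/I3_cases.
rewrite !big_cons big_nil addr0 !big_bool [LHS]addrA /=.
by case: (i == k + 1); rewrite /= ![F _ false + _]addrC.
Qed.

Lemma tern_sum (V : nmodType) (G : tern E -> V) :
  \sum_p G p = \sum_v \sum_u \sum_b \sum_l \sum_c G (l, (u, b), (v, c)).
Proof.
transitivity (\sum_(l : 'I_3) \sum_(u : T) \sum_b \sum_v \sum_c G (l, (u, b), (v, c))).
  rewrite !pair_sum; apply: eq_bigr => l _; rewrite pair_sum.
  by apply: eq_bigr => u _; apply: eq_bigr => b _; rewrite pair_sum.
rewrite exchange_big [RHS]exchange_big; apply: eq_bigr => u _ /=.
rewrite exchange_big [RHS]exchange_big; apply: eq_bigr => b _ /=.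
by rewrite exchange_big.
Qed.

(** The signature of the permutation which sends 0, 1, 2 to i, j, k, where the second
    value j is determined by the other two. *)
Definition sgn3 (i k : 'I_3) : K := if i == k + 1 then 1 else -1.

Lemma signed_tern_sum (I : finType) (F : tern E -> vec K I) i j k :
  uniq [:: i; j; k] ->
  let M (i j k : 'I_3) := \sum_v \sum_u
    (F (k, (u, false), (v, i != k + 1)) - F (i, (u, true), (v, j != i + 1))) in
  \sum_(p : 'I_3 * (T * bool) * (T * bool)) (-1) ^+ (p.1.2.2 (+) p.2.2) *: F p =
  sgn3 i k *: (M i j k - M i k j - M j i k + M j k i + M k i j - M k j i).
Proof.
move=> ijk M; rewrite (tern_sum (fun p => (-1) ^+ (p.1.2.2 (+) p.2.2) *: F p)).
rewrite /M -!sumrN -!big_split scaler_sumr; apply: eq_bigr => v _ /=.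
rewrite -!sumrN -!big_split scaler_sumr; apply: eq_bigr => u _ /=.
rewrite big_bool !(I3_sum _ ijk) /= !(I3_parity ijk) !negbK /sgn3.
case: (i == k + 1); rewrite /= ?expr0 ?expr1 ?scaleN1r ?scale1r;
  repeat match goal with |- context [F ?p] => generalize (F p); intro end.
all: apply/ffunP => q; rewrite !ffunE; lazy beta; ring.
Qed.

(** If A is a model of P, its coordinate of index a is a relation of the dual of P:
    in terms of monomials, the coefficients are the values of A, with the sign of
    the permutation and opposite signs for the two shapes of trees. *)
Lemma dual_tern_transp (J : finType) (A : 'Hom(vecT K (tern E), vecT K J)) (a : J) i j k :
  uniq [:: i; j; k] ->
  let M i j k := \sum_v \sum_u
    ((A (lmon i (op K v) j (op K u) k) a : K) *: lmon i (op K v) j (op K u) k -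
     (A (rmon i (op K u) j (op K v) k) a : K) *: rmon i (op K u) j (op K v) k) in
  dual_tern (transp A (bas K a)) =
  sgn3 i k *: (M i j k - M i k j - M j i k + M j k i + M k i j - M k j i).
Proof.
move=> ijk M; pose F p : vec K (tern E) := (A (bas K p) a : K) *: bas K p.
have ME i' j' k' : uniq [:: i'; j'; k'] -> M i' j' k' = \sum_v \sum_u
    (F (k', (u, false), (v, i' != k' + 1)) - F (i', (u, true), (v, j' != i' + 1))).
  move=> u'; apply: eq_bigr => v _; apply: eq_bigr => u _.
  by rewrite (lmon_bas v u u') (rmon_bas u v u').
have [ikj jik jki kij kji] := I3_uniqs ijk.
rewrite !ME // -(signed_tern_sum F ijk) lfun_vec linext_bas.
apply: eq_bigr => -[[l [u b]] [v c]] _; rewrite ffunE dual_tern_bas /F.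
by rewrite !scalerA mulrC.
Qed.

End FreeDual.

Section DualIso.
Variables (K : fieldType) (E : s2mod K) (rs : seq (vec K (tern E))).
Variables (P : bqop K) (J : finType) (A : 'Hom(vecT K (tern P), vecT K J)).
Hypothesis AP : lker A = rels P.
Variables (f : 'Hom(vecT K (gens E), vecT K (gens (s2dual P))))
          (g : 'Hom(vecT K (gens (s2dual P)), vecT K (gens E))).
Hypothesis fS : (f \o swap E = swap (s2dual P) \o f)%VF.
Hypothesis fg : (f \o g = \1)%VF.
Hypothesis gf : (g \o f = \1)%VF.
Hypothesis fR :
  forall r, r \in rs -> @ternh K E (s2dual P) f r \in limg (transp A).
Hypothesis gR :
  forall a, @ternh K (s2dual P) E g (transp A (bas K a)) \in rels (pres rs).

Fact dual_hom_rel : (@ternh K (pres rs) (koszul_dual P) f @: rels (pres rs)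
   <= rels (koszul_dual P))%VS.
Proof. by apply: pres_hom_rel => // r rrs; rewrite (dual_model AP) fR. Qed.

Fact dual_inv_rel : (@ternh K (koszul_dual P) (pres rs) g @: rels (koszul_dual P)
   <= rels (pres rs))%VS.
Proof.
rewrite (dual_model AP) -limg_comp; apply: limg_bas => a.
by rewrite comp_lfunE gR.
Qed.

(** The relations of the dual of P are spanned by the coordinates of A, so these are
    the only ones to be checked for the inverse. *)
Definition dual_iso_of : bqiso (pres rs) (koszul_dual P) :=
  @bqiso_of K (pres rs) (koszul_dual P)
    (@BQHom K (pres rs) (koszul_dual P) f fS dual_hom_rel) g fg gf dual_inv_rel.

End DualIso.

Section FreeDualIso.
Variables (K : fieldType) (T : finType).
Local Notation E := (s2free K T).
Variables (rs qs : seq (vec K (tern E))) (J : finType).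
Variable A : 'Hom(vecT K (tern E), vecT K J).

Lemma dual_image v : dual_tern K T (transp A v) \in limg (dual_tern K T \o transp A)%VF.
Proof. by rewrite -comp_lfunE memv_img ?memvf. Qed.

Hypothesis AP : lker A = rels (pres qs).
Hypothesis rsA : forall r, r \in rs -> r \in limg (dual_tern K T \o transp A)%VF.
Hypothesis Ars : forall a, dual_tern K T (transp A (bas K a)) \in rels (pres rs).

Fact free_dual_rel r : r \in rs ->
  @ternh K E (s2dual (pres qs)) (dual_gens K T) r \in limg (transp A).
Proof.
move=> /rsA /memv_imgP[v _ ->].
by rewrite -/(dual_tern K T) comp_lfunE dual_ternK memv_img ?memvf.
Qed.

Definition free_dual_iso : bqiso (pres rs) (koszul_dual (pres qs)) :=
  @dual_iso_of K E rs (pres qs) J A AP (dual_gens K T) (dual_gens K T)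
    (dual_gens_swap K T) (dual_gensK K T) (dual_gensK K T) free_dual_rel Ars.

End FreeDualIso.

(** * The dual operads *)

Section Duals.
Variable K : fieldType.

Local Notation x := (0 : 'I_3).
Local Notation y := (1 : 'I_3).
Local Notation z := (2%:R : 'I_3).
Local Notation m := (op K tt).
Local Notation w i j k := (bas K (wd i j k)).
Local Notation c := (bas K tt : vec K (gens (s2triv K))).
Local Notation b := (bas K tt : vec K (gens (s2sgn K))).
Local Notation e i := (bas K (i : 'I_3)).
Local Notation prec := (op K false).
Local Notation succ := (op K true).
Local Notation Ass_Zinb_eval :=
  (@white_eval K (Ass K) (Zinb K) bool _ _ (fun=> m)
     (fun t : bool => if t then swap (Zinb K) m else m)
     (Ass_model K) (Zinb_model K)).
Local Notation Lie_Zinb_eval :=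
  (@white_eval K (Lie K) (Zinb K) unit _ _ (fun=> b) (fun=> m)
     (Lie_model K) (Zinb_model K)).

Lemma sum_unit (V : nmodType) (F : unit -> V) : \sum_v F v = F tt.
Proof. by rewrite (big_pred1 tt) // => -[]. Qed.

Lemma sum_bool (V : nmodType) (F : bool -> V) : \sum_v F v = F true + F false.
Proof. exact: big_bool. Qed.

Lemma sgn3_012 : sgn3 K x z = 1.
Proof. by []. Qed.

Lemma sgn3_021 : sgn3 K x y = -1.
Proof. by []. Qed.

(** Evaluates the coordinates of a model at words on the distinct letters i, j, k. *)
Ltac coefficients ijk :=
  rewrite ?(basE, ffunE) ?wd_eq // ?eqxx ?(I3_neq ijk) /=.

(** Closes linear identities between monomials; equal monomials must be made
    syntactically equal first, hence the unfolding of the coercions. *)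
Ltac linear_monomials :=
  rewrite ?/reverse_coercion;
  repeat match goal with
  | |- context [@lmon ?F ?E ?a ?b ?c ?d ?e] =>
    generalize (@lmon F E a b c d e); intro
  | |- context [@rmon ?F ?E ?a ?b ?c ?d ?e] =>
    generalize (@rmon F E a b c d e); intro
  end;
  apply/ffunP => ?; rewrite !ffunE /GRing.scale /=; ring.

(** In the following lemmas the coordinates of the models of Ass, Leib, Zinb, preLie
    and Dend become the relations of Ass, Zinb, Leib, Perm and diAss. *)

Lemma Ass_dual_relation i j k : uniq [:: i; j; k] ->
  dual_tern K unit (transp (Ass_model K) (w i j k)) =
  sgn3 K i k *: (lmon i m j m k - rmon i m j m k).
Proof.
move=> ijk; rewrite (dual_tern_transp _ _ ijk) !sum_unit.
have [ikj jik jki kij kji] := I3_uniqs ijk.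
rewrite !Ass_model_lmon // !Ass_model_rmon //.
by coefficients ijk; congr (_ *: _); linear_monomials.
Qed.

Lemma Leib_dual_relation i j k : uniq [:: i; j; k] ->
  dual_tern K unit (transp (Leib_model K) (w i j k)) =
  sgn3 K i k *: (lmon i m j m k - (rmon i m j m k + rmon i m k m j)).
Proof.
move=> ijk; rewrite (dual_tern_transp _ _ ijk) !sum_unit.
have [ikj jik jki kij kji] := I3_uniqs ijk.
rewrite !Leib_model_lmon // !Leib_model_rmon //.
by coefficients ijk; congr (_ *: _); linear_monomials.
Qed.

Lemma Zinb_dual_relation i j k : uniq [:: i; j; k] ->
  dual_tern K unit (transp (Zinb_model K) (w i j k)) =
  sgn3 K i k *: (lmon i m j m k - (rmon i m j m k + lmon i m k m j)).
Proof.
move=> ijk; rewrite (dual_tern_transp _ _ ijk) !sum_unit.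
have [ikj jik jki kij kji] := I3_uniqs ijk.
rewrite !Zinb_model_lmon // !Zinb_model_rmon //.
by coefficients ijk; congr (_ *: _); linear_monomials.
Qed.

Lemma preLie_dual_relation1 i j k : uniq [:: i; j; k] ->
  dual_tern K unit (transp Lie_Zinb_eval (tens (e i) (w i j k))) =
  sgn3 K i k *: (lmon i m j m k - lmon i m k m j).
Proof.
move=> ijk; rewrite tens_bas (dual_tern_transp _ _ ijk) !sum_unit.
have [ikj jik jki kij kji] := I3_uniqs ijk.
rewrite !Lie_Zinb_lmon // !Lie_Zinb_rmon //.
by coefficients ijk; congr (_ *: _); linear_monomials.
Qed.

Lemma preLie_dual_relation2 i j k : uniq [:: i; j; k] ->
  dual_tern K unit (transp Lie_Zinb_eval (tens (e j) (w i j k))) =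
  - sgn3 K i k *: (lmon i m j m k - rmon i m j m k).
Proof.
move=> ijk; rewrite tens_bas (dual_tern_transp _ _ ijk) !sum_unit.
have [ikj jik jki kij kji] := I3_uniqs ijk.
rewrite !Lie_Zinb_lmon // !Lie_Zinb_rmon //.
by coefficients ijk; rewrite scaleNr -scalerN; congr (_ *: _); linear_monomials.
Qed.

Lemma preLie_dual_relation3 i j k : uniq [:: i; j; k] ->
  dual_tern K unit (transp Lie_Zinb_eval (tens (e k) (w i j k))) =
  sgn3 K i k *: (lmon i m k m j - rmon i m j m k).
Proof.
move=> ijk; rewrite tens_bas (dual_tern_transp _ _ ijk) !sum_unit.
have [ikj jik jki kij kji] := I3_uniqs ijk.
rewrite !Lie_Zinb_lmon // !Lie_Zinb_rmon //.
by coefficients ijk; congr (_ *: _); linear_monomials.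
Qed.

(** A monomial on the letters i, j, k in this order has the word ijk as its value
    in Ass, so the coordinates with first word ijk only see these monomials. *)
Lemma Dend_dual_block i j k v : uniq [:: i; j; k] ->
  dual_tern K bool (transp Ass_Zinb_eval (tens (w i j k) (bas K v))) =
  sgn3 K i k *: \sum_s \sum_t
    (((Ass_Zinb_eval (lmon i (op K s) j (op K t) k)) (wd i j k, v) : K) *:
       lmon i (op K s) j (op K t) k -
     ((Ass_Zinb_eval (rmon i (op K t) j (op K s) k)) (wd i j k, v) : K) *:
       rmon i (op K t) j (op K s) k).
Proof.
move=> ijk; rewrite tens_bas (dual_tern_transp _ _ ijk).
have Ez i' j' k' : uniq [:: i'; j'; k'] -> wd i j k == wd i' j' k' = false ->
    \sum_s \sum_t
    (((Ass_Zinb_eval (lmon i' (op K s) j' (op K t) k')) (wd i j k, v) : K) *: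
       lmon i' (op K s) j' (op K t) k' -
     ((Ass_Zinb_eval (rmon i' (op K t) j' (op K s) k')) (wd i j k, v) : K) *:
       rmon i' (op K t) j' (op K s) k') = 0.
  move=> ijk' ne; rewrite !sum_bool !(Ass_ZinbE K ijk') // !ffunE /= ne !mul0r.
  by rewrite !scale0r !subr0 !addr0.
have [ikj jik jki kij kji] := I3_uniqs ijk.
rewrite (Ez _ _ _ ikj) ?(Ez _ _ _ jik) ?(Ez _ _ _ jki) ?(Ez _ _ _ kij) ?(Ez _ _ _ kji);
  try by rewrite wd_eq ?(I3_neq ijk) ?andbF.
by rewrite !subr0 !addr0.
Qed.

Lemma Dend_dual_relations i j k : uniq [:: i; j; k] ->
  let D v := dual_tern K bool (transp Ass_Zinb_eval (tens (w i j k) (bas K v))) in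
  [/\ D (wd i j k) = sgn3 K i k *: (lmon i prec j prec k - rmon i prec j prec k),
      D (wd i k j) = sgn3 K i k *: (lmon i prec j prec k - rmon i prec j succ k),
      D (wd j i k) = sgn3 K i k *: (lmon i succ j prec k - rmon i succ j prec k) &
   [/\ D (wd j k i) = sgn3 K i k *: (lmon i succ j prec k - rmon i succ j prec k),
      D (wd k i j) = sgn3 K i k *: (lmon i prec j succ k - rmon i succ j succ k) &
      D (wd k j i) = sgn3 K i k *: (lmon i succ j succ k - rmon i succ j succ k)]].
Proof.
move=> ijk D; have [ikj jik jki kij kji] := I3_uniqs ijk.
do ![split]; rewrite /D Dend_dual_block // !sum_bool !(Ass_ZinbE K ijk) //;
  coefficients ijk; congr (_ *: _).
all: rewrite ?(mulr0, mulr1, addr0, add0r) !scale0r ?scale1r !(subr0, sub0r, addr0, add0r) //.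
all: exact: addrC.
Qed.

Fact Ass_dual_image r : r \in [:: lmon x m y m z - rmon x m y m z] ->
  r \in limg (dual_tern K unit \o transp (Ass_model K))%VF.
Proof.
rewrite inE => /eqP ->; have := dual_image (Ass_model K) (w x y z).
by rewrite Ass_dual_relation // sgn3_012 scale1r.
Qed.

Fact Ass_dual_rel a : dual_tern K unit (transp (Ass_model K) (bas K a)) \in rels (Ass K).
Proof. by elim/word_ind: a => i j k ijk; rewrite Ass_dual_relation // rpredZ ?AssR. Qed.

Definition Ass_dual_iso : bqiso (Ass K) (koszul_dual (Ass K)) :=
  free_dual_iso (Ass_modelP K) Ass_dual_image Ass_dual_rel.

Fact Leib_dual_image r :
  r \in [:: lmon x m y m z - (rmon x m y m z + rmon x m z m y)] ->
  r \in limg (dual_tern K unit \o transp (Leib_model K))%VF.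
Proof.
rewrite inE => /eqP ->; have := dual_image (Leib_model K) (w x y z).
by rewrite Leib_dual_relation // sgn3_012 scale1r.
Qed.

Fact Leib_dual_rel a : dual_tern K unit (transp (Leib_model K) (bas K a)) \in rels (Zinb K).
Proof. by elim/word_ind: a => i j k ijk; rewrite Leib_dual_relation // rpredZ ?ZinbR. Qed.

Definition Leib_dual_iso : bqiso (Zinb K) (koszul_dual (Leib K)) :=
  free_dual_iso (Leib_modelP K) Leib_dual_image Leib_dual_rel.

Fact Zinb_dual_image r :
  r \in [:: lmon x m y m z - (rmon x m y m z + lmon x m z m y)] ->
  r \in limg (dual_tern K unit \o transp (Zinb_model K))%VF.
Proof.
rewrite inE => /eqP ->; have := dual_image (Zinb_model K) (w x y z).
by rewrite Zinb_dual_relation // sgn3_012 scale1r.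
Qed.

Fact Zinb_dual_rel a : dual_tern K unit (transp (Zinb_model K) (bas K a)) \in rels (Leib K).
Proof. by elim/word_ind: a => i j k ijk; rewrite Zinb_dual_relation // rpredZ ?LeibR. Qed.

Definition Zinb_dual_iso : bqiso (Leib K) (koszul_dual (Zinb K)) :=
  free_dual_iso (Zinb_modelP K) Zinb_dual_image Zinb_dual_rel.

Fact preLie_dual_image r :
  r \in [:: lmon x m y m z - rmon x m y m z; rmon x m y m z - rmon x m z m y] ->
  r \in limg (dual_tern K unit \o transp Lie_Zinb_eval)%VF.
Proof.
set U := limg _.
have U1 : lmon x m y m z - rmon x m y m z \in U.
  have := dual_image Lie_Zinb_eval (tens (e y) (w x y z)).
  by rewrite preLie_dual_relation2 // sgn3_012 scaleN1r rpredN.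
have U2 : lmon x m z m y - rmon x m z m y \in U.
  have := dual_image Lie_Zinb_eval (tens (e z) (w x z y)).
  by rewrite preLie_dual_relation2 // sgn3_021 opprK scale1r.
have U3 : lmon x m z m y - rmon x m y m z \in U.
  have := dual_image Lie_Zinb_eval (tens (e z) (w x y z)).
  by rewrite preLie_dual_relation3 // sgn3_012 scale1r.
rewrite !inE => /orP[] /eqP -> //.
have -> : rmon x m y m z - rmon x m z m y =
    (lmon x m z m y - rmon x m z m y) - (lmon x m z m y - rmon x m y m z).
  by rewrite opprB [RHS]addrC addrA subrK.
exact: rpredB.
Qed.

Fact preLie_dual_rel a :
  dual_tern K unit (transp Lie_Zinb_eval (bas K a)) \in rels (Perm K).
Proof.
have L i j k : uniq [:: i; j; k] -> lmon i m j m k - lmon i m k m j \in rels (Perm K).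
  move=> ijk; have [ikj _ _ _ _] := I3_uniqs ijk.
  have := rpredB (rpredD (PermR1 K ijk) (PermR2 K ijk)) (PermR1 K ikj).
  by rewrite addrA subrK opprB addrA subrK.
case: a => l v; rewrite -tens_bas; elim/word_ind: v => i j k ijk.
have [ikj _ _ _ _] := I3_uniqs ijk.
have : l \in [:: i; j; k].
  by move: (i) (j) (k) ijk l; apply: I3_uniq_ind; elim/I3_cases; elim/I3_cases.
rewrite !inE => /or3P[] /eqP ->.
- by rewrite preLie_dual_relation1 // rpredZ ?L.
- by rewrite preLie_dual_relation2 // rpredZ ?PermR1.
rewrite preLie_dual_relation3 // rpredZ //.
by have := rpredB (PermR1 K ikj) (PermR2 K ijk);
   rewrite opprB addrA subrK.
Qed.

Definition preLie_dual_iso : bqiso (Perm K) (koszul_dual (preLie K)) :=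
  free_dual_iso (Lie_Zinb_evalP K) preLie_dual_image preLie_dual_rel.

Fact Dend_dual_image r :
  r \in [:: lmon x prec y prec z - rmon x prec y prec z;
           rmon x prec y prec z - rmon x prec y succ z;
           lmon x succ y prec z - rmon x succ y prec z;
           lmon x prec y succ z - lmon x succ y succ z;
           lmon x succ y succ z - rmon x succ y succ z] ->
  r \in limg (dual_tern K bool \o transp Ass_Zinb_eval)%VF.
Proof.
have U v := dual_image Ass_Zinb_eval (tens (w x y z) (bas K v)).
set V := limg _ in U *.
have [D1 D2 D3 [_ D5 D6]] := Dend_dual_relations (isT : uniq [:: x; y; z]).
move: (U (wd x y z)) (U (wd x z y)) (U (wd y x z)) (U (wd z x y)) (U (wd z y x)).
rewrite D1 D2 D3 D5 D6 sgn3_012 !scale1r => U1 U2 U3 U5 U6.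
rewrite !inE => /or4P[/eqP->|/eqP->|/eqP->|/orP[]/eqP->] //.
  have -> : rmon x prec y prec z - rmon x prec y succ z =
    (lmon x prec y prec z - rmon x prec y succ z) -
    (lmon x prec y prec z - rmon x prec y prec z).
    by rewrite opprB [RHS]addrC addrA subrK.
  exact: rpredB.
have -> : lmon x prec y succ z - lmon x succ y succ z =
    (lmon x prec y succ z - rmon x succ y succ z) -
    (lmon x succ y succ z - rmon x succ y succ z).
  by rewrite opprB addrA subrK.
exact: rpredB.
Qed.

Fact Dend_dual_rel a :
  dual_tern K bool (transp Ass_Zinb_eval (bas K a)) \in rels (diAss K).
Proof.
case: a => v v'; rewrite -tens_bas; elim/word_ind: v => i j k ijk.
have [D1 D2 D3 [D4 D5 D6]] := Dend_dual_relations ijk.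
have : v' \in [:: wd i j k; wd i k j; wd j i k; wd j k i; wd k i j; wd k j i].
  elim/word_ind: v' => i' j' k' ijk'; have [ikj jik jki kij kji] := I3_uniqs ijk.
  rewrite !inE !wd_eq //.
  move: i j k ijk {D1 D2 D3 D4 D5 D6 ikj jik jki kij kji}; apply: I3_uniq_ind;
    elim/I3_cases; move: i' j' k' ijk'; apply: I3_uniq_ind; by elim/I3_cases.
rewrite !inE => /or4P[/eqP->|/eqP->|/eqP->|/or3P[]/eqP->];
  rewrite ?(D1, D2, D3, D4, D5, D6); apply: rpredZ.
- exact: diAssR1.
- by have := rpredD (diAssR1 K ijk) (diAssR2 K ijk); rewrite addrA subrK.
- exact: diAssR3.
- exact: diAssR3.
- by have := rpredD (diAssR4 K ijk) (diAssR5 K ijk); rewrite addrA subrK.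
- exact: diAssR5.
Qed.

Definition Dend_dual_iso : bqiso (diAss K) (koszul_dual (Dend K)) :=
  free_dual_iso (Ass_Zinb_evalP K) Dend_dual_image Dend_dual_rel.

(** The generators of Com and Lie are not free; the twist by the sign exchanges their
    symmetries, and the identity of the line is equivariant. *)
Local Notation id1 := (\1%VF : 'End(vecT K unit)).

Lemma transpN (I J : finType) (f : 'Hom(vecT K I, vecT K J)) : transp (- f) = - transp f.
Proof.
apply: lfun_bas_eq => j; rewrite opp_lfunE !linext_bas.
by apply/ffunP => i; rewrite !ffunE opp_lfunE ffunE.
Qed.

Fact Com_dual_swap : (id1 \o swap (s2sgn K) = swap (s2dual (s2triv K)) \o id1)%VF.
Proof. by rewrite /= transp_id comp_lfun1l comp_lfun1r. Qed.

Fact Lie_dual_swap : (id1 \o swap (s2triv K) = swap (s2dual (s2sgn K)) \o id1)%VF.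
Proof. by rewrite /= transpN transp_id opprK. Qed.

Lemma transp_Com_model a :
  transp (Com_model K) (bas K a) = lmon x b y b z + lmon y b z b x + lmon z b x b y.
Proof.
have tE (i j k : 'I_3) : i == k + 1 -> lmon i b j b k = bas K (k, tt, tt).
  by move=> ik; rewrite /lmon ik /tree !tens_bas.
rewrite (tE x y z) // (tE y z x) // (tE z x y) // linext_bas.
apply/ffunP => -[[k []] []]; rewrite !ffunE linext_bas; case: a; rewrite !ffunE !xpair_eqE.
by move: k; elim/I3_cases; rewrite /= ?addr0 ?add0r.
Qed.

Lemma transp_Lie_model i :
  transp (Lie_model K) (bas K i) = tree (i + 2%:R) c c - tree (i + 1) c c.
Proof.
rewrite /tree !tens_bas linext_bas; apply/ffunP => -[[k []] []].
rewrite !ffunE linext_bas !ffunE !xpair_eqE !andbT /=.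
by move: i k; elim/I3_cases; elim/I3_cases.
Qed.

Fact Com_dual_image r : r \in [:: lmon x b y b z + lmon y b z b x + lmon z b x b y] ->
  @ternh K (s2sgn K) (s2dual (s2triv K)) id1 r \in limg (transp (Com_model K)).
Proof.
rewrite inE => /eqP ->; rewrite /ternh !tensh1 id_lfunE -(transp_Com_model tt).
by rewrite memv_img ?memvf.
Qed.

Fact Com_dual_rel a :
  @ternh K (s2dual (s2triv K)) (s2sgn K) id1 (transp (Com_model K) (bas K a)) \in rels (Lie K).
Proof.
rewrite /ternh !tensh1 id_lfunE transp_Com_model.
rewrite -[X in X \in _]id_lfunE -(act1 (s2sgn K)).
by apply: (@mem_pres _ (s2sgn K)); rewrite inE.
Qed.

Definition Com_dual_iso : bqiso (Lie K) (koszul_dual (Com K)) :=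
  dual_iso_of (Com_modelP K) Com_dual_swap (comp_lfun1l _) (comp_lfun1l _)
    Com_dual_image Com_dual_rel.

Fact Lie_dual_image r : r \in [:: lmon x c y c z - rmon x c y c z] ->
  @ternh K (s2triv K) (s2dual (s2sgn K)) id1 r \in limg (transp (Lie_model K)).
Proof.
rewrite inE => /eqP ->; rewrite /ternh !tensh1 id_lfunE Com_lmon Com_rmon.
have -> : tree z c c - tree x c c =
    transp (Lie_model K) (bas K x) + transp (Lie_model K) (bas K z).
  have [e1 e2 e3 e4] : [/\ x + z = z, x + y = y, z + z = y & z + y = x].
    by split; exact: val_inj.
  rewrite (transp_Lie_model x) (transp_Lie_model z) e1 e2 e3 e4.
  by rewrite addrA subrK.
by rewrite -linearD memv_img ?memvf.
Qed.

Fact Lie_dual_rel i :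
  @ternh K (s2dual (s2sgn K)) (s2triv K) id1 (transp (Lie_model K) (bas K i)) \in rels (Com K).
Proof. by rewrite /ternh !tensh1 id_lfunE transp_Lie_model ComR. Qed.

Definition Lie_dual_iso : bqiso (Com K) (koszul_dual (Lie K)) :=
  dual_iso_of (Lie_modelP K) Lie_dual_swap (comp_lfun1l _) (comp_lfun1l _)
    Lie_dual_image Lie_dual_rel.

Lemma Lie_Ass_dual_square :
  bqcomp (dualh (Lie_Ass K)) Ass_dual_iso = bqcomp Lie_dual_iso (Ass_Com K).
Proof.
apply: free_bqhom_eq => -[]; rewrite [LHS]comp_lfunE [RHS]comp_lfunE.
transitivity (transp (Lie_Ass_map K) (op K tt)).
  congr (transp _ _); exact: dual_gens_op.
transitivity (Ass_Com_map K m); last by rewrite id_lfunE.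
rewrite freeh_op /op linext_bas; apply/ffunP => -[]; rewrite ffunE.
rewrite /Lie_Ass_map linext_bas swap_op !ffunE.
by rewrite /= subr0.
Qed.

Lemma Ass_Com_dual_square :
  bqcomp (dualh (Ass_Com K)) Com_dual_iso = bqcomp Ass_dual_iso (Lie_Ass K).
Proof.
apply: bqhom_eq; apply: lfun_bas_eq => -[]; rewrite [LHS]comp_lfunE [RHS]comp_lfunE.
transitivity (transp (Ass_Com_map K) b); first by rewrite id_lfunE.
transitivity (dual_gens K unit (m - swap (s2free K unit) m)); last first.
  congr (dual_gens _ _ _); exact/esym/linext_bas.
rewrite linearB /= dual_gens_op dual_gens_opS opprK swap_op.
rewrite linext_bas; apply/ffunP => -[[] t]; rewrite ffunE linext_bas !ffunE /=.
by case: t; rewrite ?id_lfunE basE /= ?addr0 ?add0r.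
Qed.

Lemma Dend_Zinb_dual_square :
  bqcomp (dualh (Dend_Zinb K)) Zinb_dual_iso = bqcomp Dend_dual_iso (Leib_diAss K).
Proof.
apply: free_bqhom_eq => -[]; rewrite [LHS]comp_lfunE [RHS]comp_lfunE.
transitivity (transp (codialg_map K) m).
  congr (transp _ _); exact: dual_gens_op.
transitivity (dual_gens K bool (prec - swap (s2free K bool) succ)); last first.
  congr (dual_gens _ _ _); exact/esym/freeh_op.
rewrite linearB /= dual_gens_op dual_gens_opS opprK swap_op.
rewrite /op linext_bas; apply/ffunP => -[t u]; rewrite ffunE linext_bas !ffunE /=.
by case: t; case: u; rewrite ?flip_op ?[flip _ _ (bas _ _)]linext_bas /= basE /= ?addr0 ?add0r.
Qed.

Lemma preLie_Dend_dual_square :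
  bqcomp (dualh (preLie_Dend K)) Dend_dual_iso = bqcomp preLie_dual_iso (diAss_Perm K).
Proof.
apply: free_bqhom_eq => t; rewrite [LHS]comp_lfunE [RHS]comp_lfunE.
transitivity (transp (dialg_map K) (op K t)).
  congr (transp _ _); exact: dual_gens_op.
transitivity (dual_gens K unit (if t then swap (s2free K unit) m else m)); last first.
  congr (dual_gens _ _ _); exact/esym/freeh_op.
transitivity (if t then - swap (s2free K unit) m else m); last first.
  by case: t; rewrite ?dual_gens_op ?dual_gens_opS.
rewrite /op linext_bas; apply/ffunP => -[[] u]; rewrite ffunE linext_bas.
rewrite /=; case: t; case: u;
  rewrite ?(linearB, swap_op) /= ?[flip _ _ (bas _ _)]linext_bas ?flip_op !ffunE /=.
all: by rewrite ?subr0 ?sub0r ?oppr0.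
Qed.

End Duals.

(** * Black products with Leib *)

Section BlackProducts.
Variable K : fieldType.

(** Identifies a black product from the duals O' and P' of its factors, the white
    product Q of these duals, and the dual R of Q. *)
Definition black_iso (O P O' P' Q R : bqop K) (a : bqiso O' (koszul_dual O))
    (p : bqiso P' (koszul_dual P)) (f : bqiso Q (white O' P')) (d : bqiso R (koszul_dual Q)) :
    bqiso (black O P) R :=
  bqiso_comp (bqiso_sym d) (dual_iso (bqiso_comp (white_iso a p) f)).

(** Functoriality turns the dual of a square of white products into a square of black
    products: h' is dual to h, the white product with P' sends h' to q, and r is
    dual to q. *)
Lemma black_iso_square (P P' O1 O1' Q1 R1 O2 O2' Q2 R2 : bqop K)
    (p : bqiso P' (koszul_dual P))
    (a1 : bqiso O1' (koszul_dual O1)) (f1 : bqiso Q1 (white O1' P'))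
    (d1 : bqiso R1 (koszul_dual Q1))
    (a2 : bqiso O2' (koszul_dual O2)) (f2 : bqiso Q2 (white O2' P'))
    (d2 : bqiso R2 (koszul_dual Q2))
    (h : bqhom O1 O2) (h' : bqhom O2' O1') (q : bqhom Q2 Q1) (r : bqhom R1 R2) :
  bqcomp (dualh h) a2 = bqcomp a1 h' ->
  bqcomp f1 q = bqcomp (whiteh h' (bqid P')) f2 ->
  bqcomp (dualh q) d1 = bqcomp d2 r ->
  bqcomp (black_iso a2 p f2 d2) (blackh h (bqid P)) = bqcomp r (black_iso a1 p f1 d1).
Proof.
move=> ha hf hd; rewrite -[LHS]bqcompA -dualh_comp dualh_id.
rewrite [X in dualh X]bqcompA -whiteh_comp ha bqcomp1l.
rewrite -[iso_to p]bqcomp1r whiteh_comp -bqcompA -hf bqcompA.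
rewrite dualh_comp bqcompA (bqiso_square (esym hd)).
by rewrite -bqcompA.
Qed.

End BlackProducts.

Theorem mainTheorem2 (K : fieldType) :
  (exists (i1 : bqiso (white (Lie K) (Zinb K)) (preLie K))
          (i2 : bqiso (white (Ass K) (Zinb K)) (Dend K))
          (i3 : bqiso (white (Com K) (Zinb K)) (Zinb K)),
     bqcomp i2 (whiteh (Lie_Ass K) (bqid (Zinb K))) =
       bqcomp (preLie_Dend K) i1 /\
     bqcomp i3 (whiteh (Ass_Com K) (bqid (Zinb K))) =
       bqcomp (Dend_Zinb K) i2) /\
  (exists (j1 : bqiso (black (Lie K) (Leib K)) (Leib K))
          (j2 : bqiso (black (Ass K) (Leib K)) (diAss K))
          (j3 : bqiso (black (Com K) (Leib K)) (Perm K)),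
     bqcomp j2 (blackh (Lie_Ass K) (bqid (Leib K))) =
       bqcomp (Leib_diAss K) j1 /\
     bqcomp j3 (blackh (Ass_Com K) (bqid (Leib K))) =
       bqcomp (diAss_Perm K) j2).
Proof.
split.
  exists (bqiso_sym (Lie_Zinb_iso K)), (bqiso_sym (Ass_Zinb_iso K)), (bqiso_sym (Com_Zinb_iso K)).
  by split; apply: bqiso_square; rewrite ?Lie_Ass_Zinb_square ?Ass_Com_Zinb_square.
exists (black_iso (Lie_dual_iso K) (Leib_dual_iso K) (Com_Zinb_iso K) (Zinb_dual_iso K)),
  (black_iso (Ass_dual_iso K) (Leib_dual_iso K) (Ass_Zinb_iso K) (Dend_dual_iso K)),
  (black_iso (Com_dual_iso K) (Leib_dual_iso K) (Lie_Zinb_iso K) (preLie_dual_iso K)).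
split; apply: black_iso_square.
- exact: Lie_Ass_dual_square.
- exact: Ass_Com_Zinb_square.
- exact: Dend_Zinb_dual_square.
- exact: Ass_Com_dual_square.
- exact: Lie_Ass_Zinb_square.
- exact: preLie_Dend_dual_square.
Qed.
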